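(* Statement (A) below implies statement (B) below. (A) (Conjecture of Cornulier–Tessera–Valette) For every finitely generated group $G$ with a word metric $d_S$: $c_2(G,d_S)<\infty$ if and only if $G$ has an abelian subgroup of finite index. (B) (Finite version, conjectured by Naor) For every sequence $\{G_n\}_n$ of finite groups with $\sup_n rank(G_n)<\infty$, the following five conditions are equivalent: 1. For all $r>\sup_n rank(G_n)$, all Cayley graphs of $\{G_n\}_n$ with $r$ generators embed into Hilbert space with uniformly bounded distortion: $$\sup_n\ \sup_{S\in\binom{G_n}{r}:\ \langle S\rangle=G_n} c_2(G_n,d_S)<\infty.$$ 2. There exists $r\in\mathbb{N}$ such that all Cayley graphs of $\{G_n\}_n$ with $r$ generators embed into Hilbert space with uniformly bounded distortion: $$\sup_n\ \sup_{S\in\binom{G_n}{r}:\ \langle S\rangle=G_n} c_2(G_n,d_S)<\infty.$$ 3. For all $r>\sup_n rank(G_n)$ there exists a generating set $S_n$ of size $r$ for each $G_n$ such that the Cayley graphs embed into Hilbert space with uniformly bounded distortion: $$\sup_n\ \inf_{S\in\binom{G_n}{r}:\ \langle S\rangle=G_n} c_2(G_n,d_S)<\infty.$$ 4. There exist $r\in\mathbb{N}$ and a generating set $S_n$ of size $r$ for each $G_n$ such that the Cayley graphs embed into Hilbert space with uniformly bounded distortion: $$\sup_n\ \inf_{S\in\binom{G_n}{r}:\ \langle S\rangle=G_n} c_2(G_n,d_S)<\infty.$$ 5. There exist $r\in\mathbb{N}$ and, for each $G_n$, an abelian subgroup $H_n\le G_n$ of rank $\le r$ such that $$\sup_n[G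_n:H_n]<\infty.$$
   Context: The rank $rank(G)$ of a finitely generated group $G$ is the smallest size of a generating set of $G$. For a set $X$ and $r\in\mathbb{N}$, $\binom{X}{r}$ is the collection of all subsets of $X$ of size $r$. $\langle S\rangle$ is the subgroup generated by $S$. For a group $G$ with finite generating set $S$, the word metric $d_S$ is the shortest path metric of the Cayley graph of $G$ with respect to $S$. For a metric space $(M,d)$, $c_2(M,d)$ is the infimal bi-Lipschitz distortion of $M$ into Hilbert space $L_2$: the infimal $D>1$ for which there is a map $f:M\to L_2$ with $d(x,y)\le\|f(x)-f(y)\|_2\le D\,d(x,y)$ for all $x,y\in M$ (and $\infty$ if there is no such $D$).
   Formalization: In condition 2, r is required to be at least sup_n rank(G_n); in conditions 3 and 4, the supremum over n runs only over those G_n with at least r elements, since smaller groups have no subset of size r. *)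

(* Defs.v *)
From HB Require Import structures.
From mathcomp Require Import all_boot all_order all_algebra all_fingroup all_solvable.
From mathcomp Require Import all_classical all_reals all_analysis.

Set Implicit Arguments.
Unset Strict Implicit.
Unset Printing Implicit Defensive.

Import Order.TTheory GRing.Theory Num.Theory.

Local Open Scope classical_set_scope.
Local Open Scope ring_scope.

Section Distortion.
Context {R : realType}.

(* Square-integrable functions, not yet identified up to null sets: the
   distance 'N_2[f - g] used below does not see this identification. *)
Definition L2 : Type :=
  LfunType (@lebesgue_measure R) (lee1n 2 : (1%E <= 2%:R%:E :> \bar R)%E).

Definition L2_dist (f g : L2) : \bar R :=
  'N[@lebesgue_measure R]_(2%:R%:E) [EFin \o (f \- g)%R]%E.

Definition hilbert_distortion (M : Type) (d : M -> M -> R) : \bar R :=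
  ereal_inf [set D%:E | D in [set D : R | 1 < D /\
    exists f : M -> L2, forall x y : M,
      ((d x y)%:E <= L2_dist (f x) (f y) <= (D * d x y)%:E)%E]].

End Distortion.

Section WordMetric.
Context {G : groupType}.
Implicit Types (S H : set G) (x y : G).

Definition generates S : Prop :=
  smallest (fun H : set G => group_closed (mem H)) S = [set: G].

Definition cayley S : rel G :=
  fun x y => `[< exists2 s, S s & (y = x * s \/ x = y * s)%g >].

(* The set of path lengths is nonempty as soon as S generates G, so that the
   infimum is then a minimum. *)
Definition word_dist (R : realType) S x y : R :=
  inf [set (size p)%:R | p in
    [set p : seq G | path (cayley S) x p /\ last x p = y]].

Definition finite_index H : Prop :=
  finite_set [set [set (x * h)%g | h in H] | x in [set: G]].

End WordMetric.

Definition virtually_abelian (G : groupType) : Prop :=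
  exists H : set G, [/\ group_closed (mem H),
    {in H &, forall x y, x * y = y * x}%g & finite_index H].

Definition gen_sets (G : finGroupType) (r : nat) : set {set G} :=
  [set S : {set G} | #|S| = r /\ <<S>>%g = [set: G]%SET]%classic.

Section Sequences.
Context (R : realType) (G : nat -> finGroupType).

Definition sup_rank : \bar R :=
  ereal_sup [set ('m([set: G n]%SET)%g%:R : R)%:E | n in [set: nat]].

Definition distortions (n r : nat) : set (\bar R) :=
  [set hilbert_distortion (word_dist R [set` S]) | S in @gen_sets (G n) r].

(* The supremum of an empty family is -oo: if r is less than the rank of every
   G n this is -oo whatever the sequence G, so it is only of interest for
   sup_rank <= r. *)
Definition worst_distortion (r : nat) : \bar R :=
  ereal_sup [set ereal_sup (distortions n r) | n in [set: nat]].

(* A group with fewer than r elements has no r-element subset at all, so it is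
   left out of the supremum; otherwise the value would be +oo for all r > #|G 0|
   whatever the sequence G. If #|G n| >= r but no r-element subset generates
   G n, the inner infimum is +oo. *)
Definition best_distortion (r : nat) : \bar R :=
  ereal_sup [set ereal_inf (distortions n r) | n in [set n | (r <= #|G n|)%N]].

End Sequences.

(* Main.v *)
(* (5) => (1). If G is generated by r elements and A <= G is abelian of index <= k, then A, with
   its word metric in the Schreier generators, is quasi-isometric to G with constants depending only
   on k and r. Such an A is a quotient of Z^d by a lattice Lambda with d <= 2kr, and Lambda has a
   basis u_1, ..., u_d with sum |c_i| |u_i| <= C_d |sum c_i u_i| for the l1-norm. In the coordinates
   of this basis the word metric of A is, up to constants, the metric of a product of circles of
   lengths |u_i|, which embeds into Hilbert space with distortion O_d(1).

   (4) => (5). Otherwise there are r-generated groups G_n, embedded with distortion <= D, in which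
   every abelian subgroup has index > n. Let L be the limit of these marked groups along a
   nonprincipal ultrafilter. The limits of the Gram matrices of the embeddings are positive
   semidefinite, so L embeds with distortion <= D as well, and by (A) it has an abelian subgroup of
   finite index. Its Schreier generators satisfy finitely many commutation relations; these hold in
   almost all G_n, so almost all G_n contain an abelian subgroup of at most the same index: a
   contradiction. *)

Require Import Defs.
From mathcomp Require Import all_boot all_order all_algebra all_fingroup all_solvable.
From mathcomp Require Import all_classical all_reals all_analysis.

From HB Require Import structures.
From mathcomp Require Import measurable_realfun lra ring zify.

Set Implicit Arguments.
Unset Strict Implicit.
Unset Printing Implicit Defensive.

Import Order.TTheory GRing.Theory Num.Theory.
Import numFieldNormedType.Exports.

Local Open Scope classical_set_scope.
Local Open Scope ring_scope.

(** * Reduced bases for seminorms *)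

Section Seminorm.
Context {R : realType} {V : lmodType R}.
Implicit Types (N : V -> R) (u v x y : V) (L : set V).

Definition seminorm N :=
  (forall x y, N (x + y) <= N x + N y) /\ (forall a x, N (a *: x) = `|a| * N x).

Lemma seminorm0 N : seminorm N -> N 0 = 0.
Proof. by case=> _ NZ; rewrite -(scale0r 0) NZ normr0 mul0r. Qed.

Lemma seminormN N x : seminorm N -> N (- x) = N x.
Proof. by case=> _ NZ; rewrite -scaleN1r NZ normrN1 mul1r. Qed.

Lemma seminorm_ge0 N x : seminorm N -> 0 <= N x.
Proof.
move=> sN; have := sN.1 x (- x).
by rewrite subrr seminorm0// seminormN//; lra.
Qed.

Lemma seminormB N x y : seminorm N -> N (x - y) <= N x + N y.
Proof. by move=> sN; rewrite (le_trans (sN.1 _ _))// (seminormN y sN). Qed.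

Lemma seminorm_sum N I (r : seq I) (F : I -> V) : seminorm N ->
  N (\sum_(i <- r) F i) <= \sum_(i <- r) N (F i).
Proof.
move=> sN; elim/big_rec2: _ => [|i a b _ ab]; first by rewrite seminorm0.
by rewrite (le_trans (sN.1 _ _))// lerD2l.
Qed.

(** The seminorm of the quotient of [V] by the line of [u], kept on [V] itself: the induction on the
    dimension never changes the space, at the price of seminorms with a kernel. *)
Definition quotient_norm N u x : R := inf [set N (x - t *: u) | t in [set: R]].

Lemma quotient_norm_le N u x t : seminorm N -> quotient_norm N u x <= N (x - t *: u).
Proof.
move=> sN; apply: ge_inf; last by exists t.
by exists 0 => _ [s _ <-]; exact: seminorm_ge0.
Qed.

Lemma quotient_norm_adherent N u x e : 0 < e ->
  seminorm N -> exists t, N (x - t *: u) < quotient_norm N u x + e.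
Proof.
move=> e0 sN; have [|_ [t _ <-] H] := @inf_adherent _ [set N (x - t *: u) | t in [set: R]] _ e0.
  split; first by exists (N (x - 0 *: u)), 0.
  by exists 0 => _ [s _ <-]; exact: seminorm_ge0.
by exists t.
Qed.

Lemma quotient_norm_ge0 N u x : seminorm N -> 0 <= quotient_norm N u x.
Proof.
move=> sN; apply: lb_le_inf; first by exists (N (x - 0 *: u)), 0.
by move=> _ [s _ <-]; exact: seminorm_ge0.
Qed.

Lemma quotient_seminorm N u : seminorm N -> seminorm (quotient_norm N u).
Proof.
move=> sN.
have Zle a x : quotient_norm N u (a *: x) <= `|a| * quotient_norm N u x.
  apply/ler_addgt0Pr => e e0.
  have e1 : 0 < e / (`|a| + 1) by rewrite divr_gt0// ltr_wpDl.
  have [t Ht] := quotient_norm_adherent u x e1 sN.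
  rewrite (le_trans (quotient_norm_le u (a *: x) (a * t) sN))//.
  rewrite -scalerA -scalerBr sN.2.
  rewrite (le_trans (ler_wpM2l (normr_ge0 a) (ltW Ht)))// mulrDr lerD2l.
  by rewrite mulrCA ler_piMr ?(ltW e0)// ler_pdivrMr ?mul1r ?lerDl// ltr_wpDl.
split=> [x y|a x].
  apply/ler_addgt0Pr => e e0.
  have e1 : 0 < e / 2 by rewrite divr_gt0.
  have [t Ht] := quotient_norm_adherent u x e1 sN.
  have [s Hs] := quotient_norm_adherent u y e1 sN.
  have := quotient_norm_le u (x + y) (t + s) sN.
  have := sN.1 (x - t *: u) (y - s *: u).
  rewrite addrACA -opprD -scalerDl.
  by lra.
apply/eqP; rewrite eq_le Zle/=.
have [->|a0] := eqVneq a 0.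
  by rewrite normr0 mul0r quotient_norm_ge0.
rewrite -ler_pdivlMl ?normr_gt0// -normfV.
by have := Zle a^-1 (a *: x); rewrite scalerA mulVf// scale1r.
Qed.

(** Balls are finite only up to vectors of seminorm 0: this form of discreteness can pass from [N]
    to a quotient seminorm. *)
Definition discrete_for N L := forall r : R, exists F : seq V,
  (forall y, y \in F -> L y) /\
  forall x, L x -> N x <= r -> exists2 y, y \in F & N (x - y) = 0.

End Seminorm.

(** On the vectors of [L] in the ball of radius [N x] the seminorm takes finitely many values, those
    on [F], so a least nonzero value is attained. *)
Lemma shortest_vector (R : realType) (V : lmodType R) (N : V -> R) (L : set V) x :
  seminorm N -> discrete_for N L -> L x -> N x != 0 ->
  exists u, [/\ L u, N u != 0 & forall y, L y -> N y != 0 -> N u <= N y].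
Proof.
move=> sN dL Lx Nx.
have [F [FL HF]] := dL (N x).
have Nsub y z : N (y - z) = 0 -> N y = N z.
  move=> H; apply/eqP; rewrite eq_le; apply/andP; split.
    by have := sN.1 (y - z) z; rewrite subrK H; lra.
  by have := seminormB y (y - z) sN; rewrite subKr H; lra.
have [y yF /Nsub Nxy] := HF x Lx (lexx _).
pose F' := [seq z <- F | N z != 0].
have yF' : y \in F' by rewrite mem_filter yF -Nxy Nx.
pose i0 : seq_sub F' := SeqSub yF'.
have [i _ Hi] := @arg_minP _ R _ i0 xpredT (fun i => N (ssval i)) isT.
have := ssvalP i; rewrite mem_filter => /andP[Ni iF].
exists (ssval i); split=> //; first exact: FL.
move=> z Lz Nz; have [zx|xz] := leP (N z) (N x).
  have [w wF /Nsub zw] := HF z Lz zx.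
  have wF' : w \in F' by rewrite mem_filter wF -zw Nz.
  by rewrite zw; have := Hi (SeqSub wF') isT.
by rewrite (le_trans (Hi i0 isT))//= -Nxy ltW.
Qed.

Lemma round_int (R : realType) (t : R) : exists n : int, `|t - n%:~R| <= 2^-1.
Proof.
exists (Num.floor (t + 2^-1)); have := floor_itv (t + 2^-1) => /andP[].
by rewrite intrD ler_norml => ? ?; lra.
Qed.

(* A reduced basis: induction on the number of vectors spanning L, passing to the
   quotient seminorm by the line of a shortest vector u. Every vector of L then has
   quotient norm 0 or at least N u / 2, so the basis vectors of the quotient lift to vectors
   of comparable norm. *)
Theorem reduced_basis (R : realType) (d : nat) : exists2 C : R, 0 < C &
  forall (V : lmodType R) (N : V -> R) (L : set V) (e : 'I_d -> V),
  seminorm N -> L 0 -> (forall x y, L x -> L y -> L (x - y)) ->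
  discrete_for N L ->
  (forall x, L x -> exists t : 'I_d -> R, N (x - \sum_i t i *: e i) = 0) ->
  exists u : nat -> V, [/\ forall i, L (u i),
    forall x, L x -> exists n : nat -> int,
      N (x - \sum_(i < d) (n i)%:~R *: u i) = 0 &
    forall c : nat -> R, \sum_(i < d) `|c i| * N (u i) <=
      C * N (\sum_(i < d) c i *: u i)].
Proof.
elim: d => [|d [C C0 IH]].
  exists 1 => // V N L e sN L0 LB _ H; exists (fun=> 0); split=> // [x Lx|c].
    by have [t] := H x Lx; rewrite !big_ord0; exists (fun=> 0); rewrite big_ord0.
  by rewrite !big_ord0 seminorm0// mulr0.
(* With [T] the norm of the whole combination and [S] the weighted sum over the lifted vectors,
   [S <= 3 * C * T] and the term of [u] is at most [T + S], so the total is at most [T + 2 * S]. *)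
exists (1 + 6 * C) => [|V N L e sN L0 LB dL H]; first by rewrite addr_gt0// mulr_gt0.
have LN x : L x -> L (- x) by move=> ?; rewrite -sub0r; exact: LB.
have LD x y : L x -> L y -> L (x + y) by move=> ? /LN ?; rewrite -(opprK y); exact: LB.
have LZ x (n : int) : L x -> L (n%:~R *: x).
  move=> Lx; rewrite scaler_int.
  have Ln k : L (x *+ k) by elim: k => [|k Hk] //; rewrite mulrS; exact: LD.
  by case: n => k; [exact: Ln | exact: (LN _ (Ln k.+1))].
have [[x Lx Nx]|Nall] := pselect (exists2 x, L x & N x != 0); last first.
  have N0 x : L x -> N x = 0.
    by move=> Lx; apply/eqP; apply: contrapT => /negP Nx; apply: Nall; exists x.
  exists (fun=> 0); split=> // [x Lx|c].
    by exists (fun=> 0); rewrite big1 ?subr0 ?N0// => i _; rewrite scaler0.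
  rewrite big1 => [|i _]; last by rewrite seminorm0// mulr0.
  by apply: mulr_ge0; [lra|exact: seminorm_ge0].
have [u [Lu Nu shortest]] := shortest_vector sN dL Lx Nx.
have Nu0 : 0 < N u by rewrite lt_def Nu seminorm_ge0.
set N' := quotient_norm N u.
have sN' : seminorm N' by exact: quotient_seminorm.

(* Rounding a nearly optimal real multiple of [u] to an integer one stays in [L] and costs at most
   [N u / 2]. *)
have round y r : L y -> N' y < r -> exists2 n : int,
    L (y - n%:~R *: u) & N (y - n%:~R *: u) < r + N u / 2.
  move=> Lx' xr; have [|t Ht] := @quotient_norm_adherent _ _ N u y (r - N' y) _ sN.
    by rewrite subr_gt0.
  have [n Hn] := round_int t; exists n; first exact/LB/LZ.
  have -> : y - n%:~R *: u = (y - t *: u) + (t - n%:~R) *: u.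
    by rewrite scalerBl addrA subrK.
  rewrite (le_lt_trans (sN.1 _ _))// sN.2 ltr_leD//; first by move: Ht; rewrite -/N'; lra.
  by rewrite mulrC ler_pM2l.
(* Otherwise rounding would produce a vector of [L] that is shorter than [u] but not null. *)
have N'gap y : L y -> N' y != 0 -> N u / 2 <= N' y.
  move=> Lx' N'y; apply/ler_addgt0Pr => r r0.
  have [|n Ln] := round y (N' y + r) Lx'; first by rewrite ltrDl.
  have : N u <= N (y - n%:~R *: u).
    apply: shortest => //; apply: contraNneq N'y => H0.
    by rewrite eq_le quotient_norm_ge0// andbT -H0; exact: quotient_norm_le.
  by lra.
(* Some coefficient [s j] of [u] is nonzero, so modulo [u] and null vectors [e j] can be eliminated
   and the remaining [d] vectors span. *)
have [s Hs] := H u Lu.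
have [j sj] : exists j, s j != 0.
  apply: contrapT => Hj; move: Nu; rewrite -Hs.
  suff -> : \sum_i s i *: e i = 0 by rewrite subr0 eqxx.
  rewrite big1// => i _; have [->|si] := eqVneq (s i) 0; first by rewrite scale0r.
  by exfalso; apply: Hj; exists i.
have [|||||v [Lv gen red]] := IH V N' L (fun i => e (lift j i)).
- exact: sN'.
- exact: L0.
- exact: LB.
- move=> r; have [F [FL HF]] := dL (r + 1 + N u / 2).
  exists F; split=> // y Ly yr.
  have [|n Ln Hn] := round y (r + 1) Ly; first by rewrite (le_lt_trans yr)// ltrDl.
  have [z zF Hz] := HF _ Ln (ltW Hn).
  exists z => //; apply/eqP; rewrite eq_le quotient_norm_ge0// andbT.
  by rewrite -Hz addrAC; exact: quotient_norm_le.
- move=> y Ly; have [t Ht] := H y Ly.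
  exists (fun i => t (lift j i) - t j / s j * s (lift j i)).
  apply/eqP; rewrite eq_le quotient_norm_ge0// andbT.
  rewrite (le_trans (quotient_norm_le u _ (t j / s j) sN))//.
  have -> : y - \sum_i (t (lift j i) - t j / s j * s (lift j i)) *: e (lift j i) -
      (t j / s j) *: u =
      (y - \sum_i t i *: e i) - (t j / s j) *: (u - \sum_i s i *: e i).
    rewrite !(bigD1_ord j)//= scalerBr scalerDr scalerA mulfVK//.
    rewrite scaler_sumr.
    under eq_bigr do rewrite scalerBl.
    rewrite sumrB; under [X in _ - (_ - X)]eq_bigr do rewrite -scalerA.
    rewrite -scaler_sumr; set P := \sum_i _; set Q := _ *: \sum_i _; set E := t j *: _.
    rewrite [in RHS]opprB [RHS]addrA; congr (_ - _).
    by rewrite -[RHS]addrA [- (E + P)]opprD addrACA addNr add0r opprB [Q - P]addrC.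
  by rewrite (le_trans (seminormB _ _ sN))// Ht sN.2 Hs mulr0 addr0.
(* If [N' (v i)] is 0, rounding gives a vector shorter than [u], hence null. Otherwise it gives norm
   below [2 * N' (v i) + N u / 2], and the gap bounds the last term by [N' (v i)]. *)
have Hn i : exists n : int, N (v i - n%:~R *: u) <= 3 * N' (v i).
  have [N'0|N'0] := eqVneq (N' (v i)) 0.
    have [|n Ln Hn] := round (v i) (N u / 2) (Lv i); first by rewrite N'0 divr_gt0.
    exists n; rewrite N'0 mulr0 leNgt; apply/negP => H0.
    by have := shortest _ Ln (lt0r_neq0 H0); lra.
  have N'p : 0 < N' (v i) by rewrite lt_def N'0 seminorm_ge0.
  have [|n Ln Hn] := round (v i) (2 * N' (v i)) (Lv i); first by lra.
  by exists n; have := N'gap _ (Lv i) N'0; lra.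
have [n {}Hn] := choice Hn.
pose w i := if i is k.+1 then v k - (n k)%:~R *: u else u.
have sum_lift (c : nat -> R) :
    \sum_(i < d) c i *: w i.+1 = \sum_(i < d) c i *: v i -
      (\sum_(i < d) c i * (n i)%:~R) *: u.
  rewrite scaler_suml -sumrB; apply: eq_bigr => i _.
  by rewrite scalerBr scalerA.
have N'sum (c : nat -> R) t :
    N' (\sum_(i < d) c i *: v i) <= N (t *: u + \sum_(i < d) c i *: w i.+1).
  rewrite sum_lift addrCA -scalerBl -opprB scaleNr; exact: quotient_norm_le.
exists w; split.
- by case=> [|k] //=; exact/LB/LZ.
- move=> y Ly; have [m Hm] := gen y Ly.
  have Lz : L (y - \sum_(i < d) (m i)%:~R *: v i).
    apply: LB => //; elim/big_ind: _ => // i _; exact: LZ.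
  (* The residue has quotient norm 0, so rounding brings its norm below [N u]; minimality of [u]
     then makes it 0. *)
  have [|q Lq Hq] := round _ (N u / 2) Lz; first by rewrite Hm divr_gt0.
  exists (fun i => if i is k.+1 then m k else q + \sum_(i < d) m i * n i).
  apply/eqP/negPn/negP => Hy.
  suff E : y - \sum_(i < d.+1)
      (if val i is k.+1 then m k else q + \sum_(i < d) m i * n i)%:~R *: w i =
      y - \sum_(i < d) (m i)%:~R *: v i - q%:~R *: u.
    by move: Hy; rewrite E => /(shortest _ Lq); lra.
  rewrite big_ord_recl/=.
  have /= -> := sum_lift (fun i => (m i)%:~R).
  have qs : (\sum_(i < d) m i * n i)%:~R = \sum_(i < d) (m i)%:~R * (n i)%:~R :> R.
    by rewrite rmorph_sum; apply: eq_bigr => i _; rewrite rmorphM.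
  rewrite rmorphD/= qs.
  by rewrite scalerDl addrACA subrr addr0 opprD addrA addrAC.
- move=> c; rewrite !big_ord_recl/=.
  pose S' := \sum_(i < d) c i.+1 *: w i.+1; pose T := N (c 0%N *: u + S').
  pose S := \sum_(i < d) `|c i.+1| * N (w i.+1).
  rewrite -/S -/S' -/T.
  have HS : S <= 3 * C * T.
    have H1 := ler_wpM2l (ltW C0) (N'sum (fun i => c i.+1) (c 0%N)).
    have H2 := red (fun i => c i.+1).
    have : S <= 3 * \sum_(i < d) `|c i.+1| * N' (v i).
      rewrite mulr_sumr ler_sum// => i _; rewrite mulrCA.
      by apply: ler_wpM2l => //; exact: Hn.
    by move: H1 H2; rewrite /= -/S' -/T; lra.
  have H1 : `|c 0%N| * N u <= T + S.
    rewrite -sN.2; have := seminormB (c 0%N *: u + S') S' sN.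
    rewrite addrK => /le_trans; apply; rewrite lerD2l.
    rewrite (le_trans (seminorm_sum _ _ sN))// ler_sum// => i _.
    by rewrite sN.2.
  rewrite mulrDl mul1r; have -> : 6 * C * T = 3 * C * T + 3 * C * T by ring.
  by lra.
Qed.

(** * Abelian groups as products of circles *)

Section DistZ.
Context {R : realType}.
Implicit Types (s t : R).

(** [Num.floor (t + 2^-1)] is an integer nearest to [t], so [distZ (s - t)] is the arc length metric
    of the circle of length 1. *)
Definition distZ t : R := `|t - (Num.floor (t + 2^-1))%:~R|.

Lemma distZ_ge0 t : 0 <= distZ t. Proof. exact: normr_ge0. Qed.

Lemma distZ_le_half t : distZ t <= 2^-1.
Proof.
have := floor_itv (t + 2^-1) => /andP[].
by rewrite /distZ intrD ler_norml => ? ?; lra.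
Qed.

Lemma distZ_le t (n : int) : distZ t <= `|t - n%:~R|.
Proof.
have [tn|] := leP (2^-1) `|t - n%:~R|; first exact: le_trans (distZ_le_half t) tn.
rewrite ltr_norml => /andP[h1 h2].
suff -> : n = Num.floor (t + 2^-1) by [].
by apply/esym/floor_def; rewrite intrD; lra.
Qed.

Lemma distZ_witness t : exists n : int, distZ t = `|t - n%:~R|.
Proof. by eexists. Qed.

Lemma distZN t : distZ (- t) = distZ t.
Proof.
have H x : distZ (- x) <= distZ x.
  have [n ->] := distZ_witness x.
  by rewrite (le_trans (distZ_le _ (- n)))// mulrNz -opprD normrN.
by apply/eqP; rewrite eq_le H -{1}(opprK t) H.
Qed.

Lemma distZD s t : distZ (s + t) <= distZ s + distZ t.
Proof.
have [n ->] := distZ_witness s; have [m ->] := distZ_witness t.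
rewrite (le_trans (distZ_le _ (n + m)))// rmorphD/= opprD addrACA.
exact: ler_normD.
Qed.

Lemma distZ_addz t (n : int) : distZ (t + n%:~R) = distZ t.
Proof.
have H x (m : int) : distZ (x + m%:~R) <= distZ x.
  have [k ->] := distZ_witness x.
  rewrite (le_trans (distZ_le _ (k + m)))// rmorphD/=.
  by rewrite opprD addrACA subrr addr0.
by apply/eqP; rewrite eq_le H -{1}(addrK n%:~R t) -mulrNz H.
Qed.

Lemma distZ_lip s t : `|distZ s - distZ t| <= distZ (s - t).
Proof.
have H a b : distZ a <= distZ b + distZ (a - b).
  by have := distZD b (a - b); rewrite addrC subrK.
have := H s t; have := H t s; rewrite -(distZN (t - s)) opprB => ? ?.
by rewrite ler_norml; lra.
Qed.

Lemma distZ_id t : `|t| <= 2^-1 -> distZ t = `|t|.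
Proof.
move=> ht; apply/eqP; rewrite eq_le; apply/andP; split.
  by rewrite (le_trans (distZ_le t 0))// subr0.
have [n ->] := distZ_witness t.
have [->|n0] := eqVneq n 0; first by rewrite subr0.
have : 1 <= `|n%:~R : R| by rewrite -intr_norm ler1z -gtz0_ge1 normr_gt0.
have := lerB_dist (n%:~R : R) t.
by rewrite (distrC t); lra.
Qed.

(* The curve t |-> (distZ t, distZ (t + 1/4)) parametrises a square. *)
Lemma distZ_square s t :
  distZ (s - t) <= `|distZ s - distZ t| + `|distZ (s + 4^-1) - distZ (t + 4^-1)|.
Proof.
(* On each quarter of the circle both coordinates are affine with slope 1 or -1. *)
have sector x : 0 <= x < 1 ->
    [\/ x <= 4^-1 /\ (distZ x = x /\ distZ (x + 4^-1) = x + 4^-1),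
        4^-1 <= x <= 2^-1 /\ (distZ x = x /\ distZ (x + 4^-1) = 3 / 4 - x),
        2^-1 <= x <= 3 / 4 /\ (distZ x = 1 - x /\ distZ (x + 4^-1) = 3 / 4 - x) |
        3 / 4 <= x /\ (distZ x = 1 - x /\ distZ (x + 4^-1) = x - 3 / 4)].
  move=> hx; have E z : -1 / 2 <= z <= 1 / 2 -> distZ z = `|z|.
    by move=> hz; rewrite distZ_id// ler_norml; lra.
  have E1 z : -1 / 2 <= z - 1 <= 1 / 2 -> distZ z = `|z - 1|.
    by move=> /E <-; rewrite -(distZ_addz z (-1)) rmorphN rmorph1.
  have [h1|h1] := leP x 4^-1.
    by apply: Or41; split; [lra|split; [rewrite E ?ger0_norm; lra|rewrite E ?ger0_norm; lra]].
  have [h2|h2] := leP x 2^-1.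
    by apply: Or42; split; [lra|split; [rewrite E ?ger0_norm; lra|rewrite E1 ?ler0_norm; lra]].
  have [h3|h3] := leP x (3 / 4).
    by apply: Or43; split; [lra|split; [rewrite E1 ?ler0_norm; lra|rewrite E1 ?ler0_norm; lra]].
  by apply: Or44; split; [lra|split; [rewrite E1 ?ler0_norm; lra|rewrite E1 ?ger0_norm; lra]].
have key x y : 0 <= x < 1 -> 0 <= y < 1 -> x <= y ->
    distZ (x - y) <= `|distZ x - distZ y| + `|distZ (x + 4^-1) - distZ (y + 4^-1)|.
  move=> hx hy xy.
  (* The two arcs between [x] and [y] have lengths [y - x] and [1 - (y - x)]; both bound the
     distance. *)
  have d0 := distZ_le (x - y) 0; have d1 := distZ_le (x - y) (-1).
  rewrite subr0 ler0_norm in d0; last by lra.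
  rewrite rmorphN rmorph1 opprK ger0_norm in d1; last by lra.
  have norm_lb (u v : R) : u - v <= `|u - v| /\ v - u <= `|u - v|.
    by split; [exact: ler_norm|rewrite distrC ler_norm].
  have [n1 n2] := norm_lb (distZ x) (distZ y).
  have [n3 n4] := norm_lb (distZ (x + 4^-1)) (distZ (y + 4^-1)).
  move: n1 n2 n3 n4 d0 d1.
  move: (distZ (x - y)) (`|distZ x - _|) (`|distZ (x + _) - _|) => D N1 N2.
  by case: (sector _ hx) => -[h1 [-> ->]]; case: (sector _ hy) => -[h2 [-> ->]]; lra.
have F (x : R) : exists2 y, 0 <= y < 1 & exists n : int, x = y + n%:~R.
  exists (x - (Num.floor x)%:~R); last by exists (Num.floor x); rewrite subrK.
  by have := floor_itv x => /andP[]; rewrite intrD => ? ?; lra.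
have [x hx [n ->]] := F s; have [y hy [m ->]] := F t.
rewrite opprD addrACA -mulrNz -intrD distZ_addz !distZ_addz.
rewrite !(addrAC _ _%:~R 4^-1) !distZ_addz.
have [xy|/ltW yx] := leP x y; first exact: key.
by rewrite -distZN opprB (distrC (distZ x)) (distrC (distZ (x + _))); exact: key.
Qed.

End DistZ.

(* theta i is a coordinate on a circle R / Z scaled to length w i; up to the constant C, which
   depends only on d, the product of these circles induces the word metric of A. *)
Theorem circle_coordinates (R : realType) (d : nat) : exists2 C : R, 0 < C &
  forall (A : zmodType) (a : 'I_d -> A),
  (exists2 n, (0 < n)%N & forall i, a i *+ n = 0) ->
  (forall x, exists z : 'I_d -> int, x = \sum_i a i *~ z i) ->
  exists (theta : 'I_d -> A -> R) (w : 'I_d -> R), [/\ forall i, 0 <= w i,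
    forall x y (z : 'I_d -> int), x - y = \sum_i a i *~ z i ->
      \sum_i w i * distZ (theta i x - theta i y) <= C * \sum_i `|z i|%:~R &
    forall x y, exists2 z : 'I_d -> int, x - y = \sum_i a i *~ z i &
      \sum_i `|z i|%:~R <= C * \sum_i w i * distZ (theta i x - theta i y)].
Proof.
have [C C0 red] := reduced_basis R d.
exists (C + 1) => [|A a [n n0 an] gen]; first by rewrite addr_gt0.
pose vec (z : 'I_d -> int) : 'rV[R]_d := \row_i (z i)%:~R.
pose N (x : 'rV[R]_d) : R := \sum_i `|x 0 i|.
pose val_ (z : 'I_d -> int) := \sum_i a i *~ z i.
(* The lattice of relations between the [a i]: [A] is the group of integer vectors modulo [L]. *)
pose L := [set vec z | z in [set z | val_ z = 0]].
have sN : seminorm N.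
  split=> [x y|c x].
    by rewrite /N -big_split/=; apply: ler_sum => i _; rewrite mxE ler_normD.
  by rewrite /N mulr_sumr; apply: eq_bigr => i _; rewrite mxE normrM.
have N0 x : N x = 0 -> x = 0.
  move=> /eqP; rewrite psumr_eq0// => /allP H; apply/rowP => i; rewrite mxE.
  by have := H i (mem_index_enum _); rewrite normr_eq0 => /eqP.
have Nvec z : N (vec z) = \sum_i `|z i|%:~R.
  by apply: eq_bigr => i _; rewrite mxE intr_norm.
have vecB z z' : vec z - vec z' = vec (fun i => z i - z' i).
  by apply/rowP => i; rewrite !mxE rmorphB.
have valB z z' : val_ z - val_ z' = val_ (fun i => z i - z' i).
  by rewrite /val_ -sumrB; apply: eq_bigr => i _; rewrite mulrzBr.
have L0 : L 0.
  exists (fun=> 0); first by rewrite /= /val_ big1// => i _; rewrite mulr0z.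
  by apply/rowP => i; rewrite !mxE.
have LB x y : L x -> L y -> L (x - y).
  move=> [z z0 <-] [z' z'0 <-]; exists (fun i => z i - z' i); last by rewrite vecB.
  by rewrite /= -valB z0 z'0 subr0.
have dL : discrete_for N L.
  move=> r; pose B := `|Num.ceil r|%N.
  pose F := [seq x <- [seq vec (fun i => (f i : nat)%:Z - B%:Z) |
                         f : {ffun 'I_d -> 'I_(B + B).+1}] | `[< L x >]].
  exists F; split=> [y|x Lx xr].
    by rewrite mem_filter => /andP[/asboolP].
  exists x; last by rewrite subrr seminorm0.
  rewrite mem_filter; apply/andP; split; first exact/asboolP.
  have [z z0 zx] := Lx.
  have zB i : `|z i| <= B%:Z.
    have : (`|z i|%:~R : R) <= r.
      by rewrite (le_trans _ xr)// -zx Nvec (bigD1 i)//= lerDl sumr_ge0.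
    move=> zr; have : (`|z i| <= Num.ceil r).
      by rewrite -(ler_int R) (le_trans zr)// ceil_ge.
    by rewrite /B; lia.
  apply/mapP; exists [ffun i : 'I_d => inord (absz (z i + B%:Z))]; first by rewrite mem_enum.
  rewrite -zx; apply/rowP => i; rewrite !mxE ffunE inordK; last by have := zB i; lia.
  by congr _%:~R; have := zB i; lia.
have spanL x : L x -> exists t : 'I_d -> R, N (x - \sum_i t i *: delta_mx 0 i) = 0.
  move=> _; exists (fun i => x 0 i).
  by rewrite -row_sum_delta subrr seminorm0.
have [u [Lu gL redu]] := red _ _ _ _ sN L0 LB dL spanL.
have LZ x (k : int) : L x -> L (k%:~R *: x).
  move=> [z z0 <-]; exists (fun i => z i * k).
    rewrite /= /val_; under eq_bigr do rewrite mulrzA.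
    by rewrite -mulrz_suml -/(val_ z) z0 mul0rz.
  by apply/rowP => i; rewrite !mxE rmorphM mulrC.
(* Torsion gives [L] full rank: [n] times any integer vector is a relation, so every integer vector
   has real coordinates in the reduced basis. *)
have coordP z : exists c : nat -> R, vec z = \sum_(i < d) c i *: u i.
  have Ln : L (n%:R *: vec z).
    exists (fun i => z i * n%:Z).
      rewrite /= /val_ big1// => i _.
      by rewrite mulrC mulrzA -pmulrn an mul0rz.
    by apply/rowP => i; rewrite !mxE rmorphM mulrC.
  have [m /N0/eqP] := gL _ Ln; rewrite subr_eq0 => /eqP Hm.
  exists (fun i => n%:R^-1 * (m i)%:~R).
  under eq_bigr do rewrite -scalerA.
  by rewrite -scaler_sumr -Hm scalerA mulVf ?scale1r// pnatr_eq0 -lt0n.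
(* [c x] will be the coordinates of a chosen lift [zc x] of [x]. Another lift changes them by
   integers, which [distZ] ignores. *)
have [zc zcE] := choice gen.
have [c cE] := choice (fun x => coordP (zc x)).
exists (fun i x => c x i), (fun i => N (u i)); split.
- by move=> i; exact: seminorm_ge0.
- move=> x y z xyz.
  have Lz : L (vec (zc x) - vec (zc y) - vec z).
    exists (fun i => zc x i - zc y i - z i); last by rewrite !vecB.
    by rewrite /= -!valB /val_ -!zcE xyz subrr.
  have [m /N0/eqP] := gL _ Lz; rewrite subr_eq0 => /eqP Hm.
  (* Each of these coordinates dominates the corresponding [distZ], and reducedness bounds their
     weighted sum by [C * N (vec z)]. *)
  have zE : vec z = \sum_(i < d) (c x i - c y i - (m i)%:~R) *: u i.
    under eq_bigr do rewrite !scalerBl.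
    by rewrite !sumrB -!cE -Hm subKr.
  rewrite -Nvec zE.
  apply: (@le_trans _ _ (C * N (vec z))).
    rewrite zE (le_trans _ (redu (fun i => c x i - c y i - (m i)%:~R)))//.
    by apply: ler_sum => i _; rewrite mulrC ler_wpM2r ?seminorm_ge0// distZ_le.
  by rewrite zE ler_wpM2r ?seminorm_ge0// lerDl.
- move=> x y.
  (* The nearest integers to the coordinate differences: subtracting the relation [z0] with these
     coordinates leaves a vector whose coordinates have absolute value [distZ]. *)
  pose m i := Num.floor (c x i - c y i + 2^-1).
  have [z0 z00 z0E] : L (\sum_(i < d) (m i)%:~R *: u i).
    elim/big_ind: _ => // [p q Lp Lq|i _]; last exact/LZ.
    by rewrite -(opprK q); apply: (LB) => //; rewrite -sub0r; exact: LB.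
  exists (fun i => zc x i - zc y i - z0 i).
    by rewrite -/(val_ _) -!valB z00 subr0 /val_ -!zcE.
  rewrite -Nvec -!vecB z0E !cE -!sumrB.
  rewrite (le_trans (seminorm_sum _ _ sN))//.
  rewrite mulrDl mul1r -[leLHS]add0r lerD//.
    apply: mulr_ge0; first exact: ltW.
    by apply: sumr_ge0 => i _; apply: mulr_ge0; [exact: seminorm_ge0|exact: distZ_ge0].
  by apply: ler_sum => i _; rewrite -!scalerBl sN.2 mulrC.
Qed.

(** * Embeddings into L2 *)

Section InnerProduct.
Context {R : realType}.
Local Notation mu := (@lebesgue_measure R).
Local Notation H := (LfunType mu (lee1n 2 : (1%E <= 2%:R%:E :> \bar R)%E)).
Implicit Types (f g h : H).

Definition ip f g : R := \int[mu]_x (f x * g x).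

Lemma integrable_mul f g : mu.-integrable setT (EFin \o (fun x => f x * g x)).
Proof. by apply/Lfun1_integrable; apply: Lfun2_mul_Lfun1; exact: LfunP. Qed.

Lemma ipC f g : ip f g = ip g f.
Proof. by apply: eq_Rintegral => x _; rewrite mulrC. Qed.

Lemma ipDl f g h : ip (f + g) h = ip f h + ip g h.
Proof.
rewrite -RintegralD//; [|exact: integrable_mul..].
by apply: eq_Rintegral => x _; rewrite -mulrDl.
Qed.

Lemma ipZl a f h : ip (a *: f) h = a * ip f h.
Proof.
rewrite -RintegralZl//; last exact: integrable_mul.
by apply: eq_Rintegral => x _; rewrite mulrA.
Qed.

Lemma ip_ge0 f : 0 <= ip f f.
Proof. by apply: Rintegral_ge0 => x _; rewrite -expr2 sqr_ge0. Qed.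

Lemma ip0l f : ip 0 f = 0.
Proof. by rewrite -(scale0r 0) ipZl mul0r. Qed.

Lemma ip_suml I (r : seq I) (F : I -> H) h :
  ip (\sum_(i <- r) F i) h = \sum_(i <- r) ip (F i) h.
Proof.
by elim: r => [|i r IH]; rewrite ?big_nil ?ip0l// !big_cons ipDl IH.
Qed.

Lemma ip_sumr I (r : seq I) (F : I -> H) h :
  ip h (\sum_(i <- r) F i) = \sum_(i <- r) ip h (F i).
Proof. by rewrite ipC ip_suml; apply: eq_bigr => i _; rewrite ipC. Qed.

Lemma ipBB f g : ip (f - g) (f - g) = ip f f + ip g g - 2 * ip f g.
Proof.
rewrite -scaleN1r ipDl ipZl !(ipC _ (f + _)) !ipDl !ipZl (ipC g f).
by ring.
Qed.

Lemma ipDD f g : ip (f + g) (f + g) = ip f f + ip g g + 2 * ip f g.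
Proof. by rewrite ipDl !(ipC _ (f + g)) !ipDl (ipC g f); ring. Qed.

Lemma L2_distE f g : L2_dist f g = (Num.sqrt (ip (f - g) (f - g)))%:E.
Proof.
rewrite /L2_dist unlock /=.
have -> : (\int[mu]_x (`|(f x - g x)%:E| `^ 2) = (ip (f - g) (f - g))%:E)%E.
  rewrite /ip /Rintegral fineK; last first.
    by apply: integrable_fin_num => //; exact: integrable_mul.
  apply: eq_integral => x _ /=.
  by rewrite powR_mulrn// real_normK ?num_real// expr2.
by rewrite poweR_EFin powR12_sqrt// ip_ge0.
Qed.

(** These indicators form an orthonormal sequence, through which [step] places finite coordinate
    vectors isometrically in L2. *)
Definition box_fun (k : nat) : R -> R := \1_(`[k%:R, k.+1%:R[ : set R).

Lemma lebesgue_measure_box (k : nat) : (mu `[k%:R, k.+1%:R[%classic = 1)%E.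
Proof.
rewrite lebesgue_measure_itv/= lte_fin ltr_nat ltnS leqnn.
by rewrite -EFinB/= -natrB// subSnn.
Qed.

Lemma box_fun_sqr k x : box_fun k x * box_fun k x = box_fun k x.
Proof. by rewrite /box_fun indicE -natrM mulnb andbb. Qed.

Lemma integral_box k : (\int[mu]_x (box_fun k x)%:E = 1)%E.
Proof. by rewrite integral_indic// setIT; exact: lebesgue_measure_box. Qed.

Lemma box_Lfun k : box_fun k \in Lfun mu 2%:R%:E.
Proof.
apply/andP; split; rewrite inE/=; first exact: measurable_indic.
rewrite /finite_norm unlock poweR_lty//.
under eq_integral.
  move=> x _; rewrite /= powR_mulrn// real_normK ?num_real// expr2 box_fun_sqr.
  over.
by rewrite integral_box ltry.
Qed.

Definition box k : H := Lfun_Sub _ (box_Lfun k).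

Lemma ip_box i j : ip (box i) (box j) = (i == j)%:R.
Proof.
rewrite /ip /=; have [<-|ij] := eqVneq i j.
  rewrite /Rintegral; under eq_integral do rewrite box_fun_sqr.
  by rewrite integral_box.
have E x : box_fun i x * box_fun j x = 0.
  rewrite /box_fun !indicE -natrM mulnb; apply/eqP; rewrite pnatr_eq0 eqb0.
  apply/negP => /andP[]; rewrite !inE/= !in_itv/= => /andP[h1 h2] /andP[h3 h4].
  have := le_lt_trans h1 h4; have := le_lt_trans h3 h2.
  by rewrite !ltr_nat; move: ij; lia.
by rewrite /Rintegral integral0_eq// => x _; rewrite E.
Qed.

Definition step m (c : nat -> R) : H := \sum_(i < m) c i *: box i.

Lemma step_widen m M c : (m <= M)%N -> (forall i, (m <= i)%N -> c i = 0) ->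
  step m c = step M c.
Proof.
move=> mM c0; rewrite /step (big_ord_widen M (fun i => c i *: box i))// big_mkcond.
by apply: eq_bigr => i _; case: ltnP => // /c0 ->; rewrite scale0r.
Qed.

Lemma step_dist M c c' :
  L2_dist (step M c) (step M c') = (Num.sqrt (\sum_(i < M) (c i - c' i) ^+ 2))%:E.
Proof.
rewrite L2_distE; congr (Num.sqrt _)%:E.
rewrite /step -sumrB; under eq_bigr do rewrite -scalerBl.
rewrite ip_suml; apply: eq_bigr => i _; rewrite ipZl ip_sumr expr2; congr (_ * _).
rewrite (bigD1 i)//= big1 => [|j ji]; rewrite ipC ipZl ip_box.
  by rewrite eqxx mulr1 addr0.
by rewrite (val_eqE j i) (negbTE ji) mulr0.
Qed.

Lemma sqrt_sum_bounds k (x : 'I_k -> R) :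
  Num.sqrt (\sum_i x i ^+ 2) <= \sum_i `|x i| <= k%:R * Num.sqrt (\sum_i x i ^+ 2).
Proof.
apply/andP; split.
  rewrite -(ler_sqr (x := Num.sqrt _)) ?nnegrE ?sqrtr_ge0 ?sumr_ge0//.
  rewrite sqr_sqrtr ?sumr_ge0// => [|i _]; last exact: sqr_ge0.
  rewrite expr2 mulr_suml; apply: ler_sum => i _.
  rewrite -real_normK ?num_real// expr2 ler_wpM2l//.
  by rewrite (bigD1 i)//= lerDl sumr_ge0.
set Q := Num.sqrt _; have -> : k%:R * Q = \sum_(i < k) Q.
  by rewrite sumr_const card_ord mulr_natl.
apply: ler_sum => i _; rewrite -sqrtr_sqr ler_wsqrtr// (bigD1 i)//= lerDl sumr_ge0// => j _.
exact: sqr_ge0.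
Qed.

End InnerProduct.

(** Passing from the l1-norm to the l2-norm costs at most a factor [#|I|], and rescaling the
    coordinates makes the map non-contracting. *)
Lemma hilbert_distortion_coord (R : realType) (M : Type) (d : M -> M -> R)
    (I : finType) (phi : M -> I -> R) (c : R) : 1 <= c ->
  (forall x y, d x y <= c * \sum_i `|phi x i - phi y i|) ->
  (forall x y, \sum_i `|phi x i - phi y i| <= c * d x y) ->
  (hilbert_distortion d <= (#|I|.+1%:R * c * c + 1)%:E)%E.
Proof.
move=> c1 lo up; have c0 : 0 <= c by rewrite (le_trans _ c1).
(* The summand 1 makes the constant exceed 1 strictly; [k.+1] keeps the product positive even for
   empty [I]. *)
set k := #|I|; apply: ereal_inf_lbound; exists (k.+1%:R * c * c + 1) => //=; split.
  rewrite ltrDr !mulr_gt0//; exact: lt_le_trans c1.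
pose coord x i := k.+1%:R * c * (if insub i is Some j then phi x (@enum_val I I j) else 0).
exists (fun x => step k (coord x)) => x y.
rewrite step_dist.
have -> : \sum_(i < k) (coord x i - coord y i) ^+ 2 =
    (k.+1%:R * c) ^+ 2 * \sum_(i < k) (phi x (enum_val i) - phi y (enum_val i)) ^+ 2.
  by rewrite mulr_sumr; apply: eq_bigr => i _; rewrite /coord valK -mulrBr exprMn.
rewrite sqrtrM ?sqr_ge0// sqrtr_sqr ger0_norm ?mulr_ge0//.
have /andP[h1 h2] := sqrt_sum_bounds (fun i : 'I_k => phi x (enum_val i) - phi y (enum_val i)).
have {}lo := lo x y; have {}up := up x y.
have sumE (F : I -> R) : \sum_i F i = \sum_(i < k) F (enum_val i).
  by rewrite -(big_enum_val (A := I)); exact: eq_bigl.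
rewrite sumE in lo; rewrite sumE in up.
set S := \sum_(i < k) `|_| in lo up h1 h2. set Q := Num.sqrt _ in h1 h2 *.
have Q0 : 0 <= Q by exact: sqrtr_ge0.
have S0 : 0 <= S by exact: sumr_ge0.
have d0 : 0 <= d x y by rewrite -(pmulr_rge0 _ (lt_le_trans ltr01 c1)) (le_trans S0).
rewrite !lee_fin; apply/andP; split.
  rewrite (le_trans lo)// [_ * c]mulrC -mulrA ler_wpM2l//.
  by rewrite (le_trans h2)// ler_wpM2r// ler_nat.
set K := k.+1%:R * c.
have : K * Q <= K * (c * d x y) by rewrite ler_wpM2l ?mulr_ge0// (le_trans h1 up).
by rewrite mulrA mulrDl mul1r; lra.
Qed.

(** * Positive semidefinite kernels and their realization in L2 *)

Section Gram.
Context {R : realType}.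
Implicit Types K : nat -> nat -> R.

(** A finitely supported vector is a list of weighted indices, in which an index may recur. *)
Definition qform K (s : seq (R * nat)) : R :=
  \sum_(x <- s) \sum_(y <- s) x.1 * y.1 * K x.2 y.2.

Definition psd K := (forall i j, K i j = K j i) /\ (forall s, 0 <= qform K s).

(** The Schur complement at the pivot [p]. If [K p p = 0], the inverse is 0 by convention and the
    kernel is unchanged. *)
Definition schur K p i j : R := K i j - K i p * K j p / K p p.

(** Completing the square: adjoining [p] to [s] with weight [- (b / K p p)] turns the form of [K]
    into the form of the complement on [s]. *)
Lemma schur_psd K p : psd K -> psd (schur K p).
Proof.
move=> [KC K0]; split=> [i j|s]; first by rewrite /schur KC (mulrC (K i p)).
have B : qform (schur K p) s = qform K s - (\sum_(x <- s) x.1 * K x.2 p) ^+ 2 / K p p.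
  rewrite /qform expr2 !mulr_suml -sumrB; apply: eq_bigr => x _.
  rewrite mulr_sumr mulr_suml -sumrB; apply: eq_bigr => y _.
  by rewrite /schur; ring.
set b := \sum_(x <- s) _ in B.
have [p0|p0] := eqVneq (K p p) 0; first by rewrite B p0 invr0 mulr0 subr0.
have := K0 ((- (b / K p p), p) :: s).
rewrite {1}/qform big_cons big_cons/=.
under [X in _ + X]eq_bigr do rewrite big_cons/=.
rewrite big_split/= -/(qform K s).
have -> : \sum_(y <- s) - (b / K p p) * y.1 * K p y.2 = - (b / K p p) * b.
  by rewrite mulr_sumr; apply: eq_bigr => y _; rewrite KC mulrA.
have -> : \sum_(y <- s) y.1 * - (b / K p p) * K y.2 p = - (b / K p p) * b.
  by rewrite mulr_sumr; apply: eq_bigr => y _; ring.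
rewrite B; congr (0 <= _); first by field.
Qed.

Lemma psd_diag_ge0 K i : psd K -> 0 <= K i i.
Proof.
by case=> _ /(_ [:: (1, i)]); rewrite /qform !big_seq1/= !mul1r.
Qed.

Lemma psd_diag0 K p i : psd K -> K p p = 0 -> K i p = 0.
Proof.
move=> [KC K0] p0; apply/eqP; apply: contrapT => /negP Kip.
(* As [K p p = 0], the form is affine in the weight of [p]; this weight gives it the value -1. *)
have := K0 [:: (1, i); (- (K i i + 1) / (2 * K i p), p)].
rewrite /qform !big_cons !big_nil/= p0 (KC p i).
set E := (X in 0 <= X).
have -> : E = -1 by rewrite /E; field.
by lra.
Qed.

Lemma schur_pivot K p i : psd K -> schur K p i p = 0.
Proof.
move=> psdK; rewrite /schur.
have [p0|p0] := eqVneq (K p p) 0; first by rewrite p0 invr0 mulr0 subr0 psd_diag0.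
by rewrite mulfK// subrr.
Qed.

(* An infinite Cholesky factorisation: taking successive Schur complements writes K as a sum of
   rank-one kernels c_k (x) c_k whose k-th term vanishes on the indices i < k. *)
Theorem psd_realization K : psd K -> exists F : nat -> L2 (R := R), forall i j,
  L2_dist (F i) (F j) = (Num.sqrt (K i i + K j j - 2 * K i j))%:E.
Proof.
move=> psdK; pose Kn n := iteri n (fun p K => schur K p) K.
have psdn n : psd (Kn n) by elim: n => //= n; exact: schur_psd.
have col0 n i p : (p < n)%N -> Kn n i p = 0.
  elim: n i p => //= n IH i p; rewrite ltnS leq_eqVlt => /predU1P[->|pn].
    exact: schur_pivot.
  by rewrite /schur IH// ((psdn n).1 p n) (IH _ _ pn) mulr0 mul0r subr0.
pose c i k := Kn k i k / Num.sqrt (Kn k k k).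
(* Each complement splits off the rank-one kernel of the normalised pivot column. *)
have KE n i j : K i j = Kn n i j + \sum_(k < n) c i k * c j k.
  elim: n => [|n IH]; first by rewrite big_ord0 addr0.
  rewrite IH big_ord_recr/= [in RHS]addrCA addrC; congr (_ + _).
  suff -> : c i n * c j n = Kn n i n * Kn n j n / Kn n n n by rewrite /schur subrK.
  by rewrite /c mulrACA -invfM -expr2 sqr_sqrtr ?psd_diag_ge0.
exists (fun i => step i.+1 (c i)) => i j.
have c0 l k : (l.+1 <= k)%N -> c l k = 0.
  by move=> lk; rewrite /c (psdn k).1 col0// mul0r.
(* From [M] on both coefficient sequences vanish, and [Kn M] is 0 at the pairs formed from [i] and
   [j], so the finite sums are exact. *)
pose M := (maxn i j).+1.
rewrite (step_widen (M := M) _ (c0 i)) ?ltnS ?leq_maxl//.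
rewrite (step_widen (M := M) _ (c0 j)) ?ltnS ?leq_maxr//.
rewrite step_dist; congr (Num.sqrt _)%:E.
rewrite (KE M i i) (KE M j j) (KE M i j) !col0 ?ltnS ?leq_maxl ?leq_maxr//.
rewrite !add0r mulr_sumr -big_split -sumrB/=; apply: eq_bigr => k _; ring.
Qed.

Lemma gram_psd (g : nat -> L2 (R := R)) : psd (fun i j => ip (g i) (g j)).
Proof.
split=> [i j|s]; first exact: ipC.
have -> : qform (fun i j => ip (g i) (g j)) s =
    ip (\sum_(x <- s) x.1 *: g x.2) (\sum_(x <- s) x.1 *: g x.2).
  rewrite ip_suml; apply: eq_bigr => x _; rewrite ipZl ip_sumr mulr_sumr.
  by apply: eq_bigr => y _; rewrite (ipC (g x.2) (_ *: _)) ipZl (ipC (g y.2)) mulrA.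
exact: ip_ge0.
Qed.

End Gram.

(** * Walks in Cayley graphs *)

Local Open Scope group_scope.

Section Walk.
Context {G : groupType}.
Implicit Types (S : set G) (x y z g : G) (l m : nat).

(** Length at most [l] instead of exactly [l], so that bounds can be weakened freely. *)
Definition walk S l x y :=
  exists p, [/\ path (cayley S) x p, last x p = y & (size p <= l)%N].

Lemma walk_refl S x : walk S 0 x x. Proof. by exists [::]. Qed.

Lemma walk0 S x y : walk S 0 x y -> x = y.
Proof. by case=> -[|z p] []. Qed.

Lemma walk_step S l x y z : cayley S x z -> walk S l z y -> walk S l.+1 x y.
Proof. by move=> xz [p [pp pl ps]]; exists (z :: p); rewrite /= xz. Qed.

Lemma walk_stepP S l x y : walk S l.+1 x y ->
  x = y \/ exists2 z, cayley S x z & walk S l z y.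
Proof.
case=> -[|z p] []/=; first by left.
by move=> /andP[xz pp] pl ps; right; exists z => //; exists p.
Qed.

Lemma walk_mono S l m x y : (l <= m)%N -> walk S l x y -> walk S m x y.
Proof. by move=> lm [p [pp pl ps]]; exists p; rewrite (leq_trans ps). Qed.

Lemma walk_trans S l m x y z : walk S l x y -> walk S m y z -> walk S (l + m) x z.
Proof.
move=> [p [pp pl ps]] [q [qp ql qs]]; exists (p ++ q).
by rewrite cat_path last_cat size_cat pl pp leq_add.
Qed.

Lemma cayley_sym S x y : cayley S x y -> cayley S y x.
Proof.
by move=> /asboolP[s Ss [] E]; apply/asboolP; exists s => //; [right|left].
Qed.

Lemma cayley_mul S g x y : cayley S x y -> cayley S (g * x) (g * y).
Proof.
by move=> /asboolP[s Ss [] ->]; apply/asboolP; exists s => //; rewrite mulgA; [left|right].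
Qed.

Lemma walk_sym S l x y : walk S l x y -> walk S l y x.
Proof.
elim: l x => [|l IH] x; first by move/walk0 ->; exact: walk_refl.
move=> /walk_stepP[->|[z xz zy]]; first exact: walk_mono (walk_refl S y).
rewrite -addn1; apply: walk_trans (IH _ zy) _.
by apply: walk_step (walk_refl S x); exact: cayley_sym.
Qed.

Lemma walk_mul S l g x y : walk S l x y -> walk S l (g * x) (g * y).
Proof.
elim: l x => [|l IH] x; first by move/walk0 ->; exact: walk_refl.
move=> /walk_stepP[->|[z xz zy]]; first exact: walk_mono (walk_refl S _).
by apply: walk_step (IH _ zy); exact: cayley_mul.
Qed.

Lemma word_dist_ge0 (R : realType) S x y : (0 <= word_dist R S x y)%R.
Proof.
rewrite /word_dist; set A := (X in inf X).
(* Without any path the infimum is over the empty set and takes the default value 0. *)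
have [A0|/set0P A0] := eqVneq A set0; first by rewrite A0 inf0.
by apply: lb_le_inf => // _ [p _ <-].
Qed.

Lemma word_dist_le (R : realType) S l x y : walk S l x y -> (word_dist R S x y <= l%:R)%R.
Proof.
move=> [p [pp pl ps]]; apply: (@le_trans _ _ (size p)%:R%R); last by rewrite ler_nat.
by apply: ge_inf; [exists 0%R => _ [q _ <-]|exists p].
Qed.

(** Path lengths are natural numbers and the given walk makes their set nonempty, so the infimum is
    attained. *)
Lemma word_dist_walk (R : realType) S l x y : walk S l x y ->
  exists2 m, word_dist R S x y = m%:R%R & walk S m x y.
Proof.
move=> W; have exW : exists m, `[< walk S m x y >] by exists l; apply/asboolP.
case: (ex_minnP exW) => m /asboolP Wm minm; exists m => //.
apply/eqP; rewrite eq_le word_dist_le//=.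
apply: lb_le_inf; first by case: W => p [pp pl _]; exists (size p)%:R%R, p.
move=> _ [p [pp pl] <-]; rewrite ler_nat; apply: minm.
by apply/asboolP; exists p.
Qed.

Lemma walk_nth S x p i : path (cayley S) x p -> (i <= size p)%N ->
  walk S i x (nth x (x :: p) i) /\ walk S (size p - i) (nth x (x :: p) i) (last x p).
Proof.
move=> pp ip; rewrite -[in last x p](cat_take_drop i p) last_cat.
have E : nth x (x :: p) i = last x (take i p).
  by rewrite (last_nth x) size_takel// -[x :: take i p]/(take i.+1 (x :: p)) nth_take.
move: pp; rewrite -{1}(cat_take_drop i p) cat_path => /andP[p1 p2].
by rewrite E; split; [exists (take i p)|exists (drop i p)]; rewrite ?size_takel ?size_drop.
Qed.

End Walk.

Lemma gen_walk (G : finGroupType) (S : {set G}) x y : <<S>> = [set: G]%SET ->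
  exists l, walk [set` S] l x y.
Proof.
move=> SG; have : x^-1 * y \in <<S>> by rewrite SG inE.
case/gen_prodgP => n [c Sc E]; exists n.
rewrite -[y](mulKVg x) E -[X in walk _ _ X _]mulg1; apply: walk_mul.
elim: n c Sc {E} => [|n IH] c Sc; first by rewrite big_ord0; exact: walk_refl.
rewrite big_ord_recl; apply: (@walk_step _ _ _ _ _ (c ord0)).
  by apply/asboolP; exists (c ord0); [exact: Sc|left; rewrite mul1g].
by rewrite -[X in walk _ _ X _]mulg1; apply/walk_mul/IH => i; exact: Sc.
Qed.

(* A shortest element of a right coset visits each right coset at most once. *)
Lemma short_coset_rep (G : finGroupType) (S : {set G}) (H : {group G}) x :
  <<S>> = [set: G]%SET ->
  exists2 t, t \in H :* x & walk [set` S] #|[set: G]%SET : H| 1 t.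
Proof.
move=> SG.
have exW : exists l, `[< exists2 t, t \in H :* x & walk [set` S] l 1 t >].
  by have [l W] := gen_walk 1 x SG; exists l; apply/asboolP; exists x; rewrite ?rcoset_refl.
case: (ex_minnP exW) => l /asboolP[t tx Wt] minl; exists t => //.
have [p [pp pt pl]] := Wt; have {minl} minl m y : y \in H :* x ->
    walk [set` S] m 1 y -> (size p <= m)%N.
  by move=> yx Wy; apply: leq_trans pl _; apply: minl; apply/asboolP; exists y.
(* The [(size p).+1] vertices then lie in distinct cosets, so [size p] is less than the index. *)
suff U : uniq [seq H :* y | y <- 1 :: p].
  exists p; split=> //; apply: ltnW; rewrite -[(size p).+1]/(size (1 :: p)).
  rewrite -(size_map (fun y => H :* y)) -(card_uniqP U).
  apply/subset_leq_card/fintype.subsetP => _ /mapP[y _ ->].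
  by rewrite mem_rcosets -[y]mul1g mem_mulg ?inE.
apply/negPn/negP => /(uniqPn (H :* 1)) [i [j [ij jp]]].
rewrite size_map/= ltnS in jp.
rewrite !(nth_map 1) ?ltnS//; last by rewrite (leq_trans (ltnW ij)).
move=> E.
have [Wi _] := walk_nth pp (leq_trans (ltnW ij) jp).
have [_ Wj] := walk_nth pp jp.
move: E Wi Wj; set u := nth 1 _ i; set v := nth 1 _ j => E Wi Wj.
(* If the cosets at [i < j] agree, translating the tail from [v] by [u * v^-1] attaches it at [u]
   and ends in the same coset after a shorter walk. *)
have huv : u * v^-1 \in H by rewrite -mem_rcoset; rewrite -E rcoset_refl.
have := minl (i + (size p - j))%N (u * v^-1 * t).
have -> : (u * v^-1 * t \in H :* x) = true.
  by rewrite mem_rcoset -mulgA groupMl// -mem_rcoset.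
have /= W2 := walk_mul (u * v^-1) Wj; rewrite mulgVK pt in W2.
move=> /(_ isT (walk_trans Wi W2)).
by move: ij jp; lia.
Qed.

(** * Ultralimits of marked groups *)

Section Words.
Context {r : nat}.
Local Notation letter := ('I_r * bool)%type.
Local Open Scope group_scope.

Section Eval.
Context {G : groupType} (s : 'I_r -> G).

Definition letter_eval (l : letter) : G := if l.2 then s l.1 else (s l.1)^-1.

Definition word_eval (w : seq letter) : G := foldr (fun l g => letter_eval l * g) 1 w.

Definition word_inv (w : seq letter) : seq letter := rev [seq (l.1, ~~ l.2) | l <- w].

Lemma word_eval_cat w v : word_eval (w ++ v) = word_eval w * word_eval v.
Proof. by elim: w => [|l w IH] /=; rewrite ?mul1g// IH mulgA. Qed.

Lemma word_eval_inv w : word_eval (word_inv w) = (word_eval w)^-1.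
Proof.
elim: w => [|l w IH]; first by rewrite /word_inv /= invg1.
rewrite /word_inv /= rev_cons -cats1 word_eval_cat -/(word_inv w) IH invMg.
by congr (_ * _); rewrite /= mulg1 /letter_eval /=; case: l.2; rewrite ?invgK.
Qed.

Lemma cayley_letterP x y : cayley (range s) x y <-> exists l, y = x * letter_eval l.
Proof.
split=> [/asboolP[_ [i _ <-] [] E]|[[i b] ->]].
- by exists (i, true).
- by exists (i, false); rewrite /letter_eval/= E mulgK.
apply/asboolP; exists (s i); first by exists i.
by rewrite /letter_eval/=; case: b; [left|right; rewrite mulgVK].
Qed.

Lemma walk_letterP l x y : walk (range s) l.+1 x y <->
  x = y \/ exists a, walk (range s) l (x * letter_eval a) y.
Proof.
split=> [/walk_stepP[|[z /cayley_letterP[a ->] W]]|[->|[a W]]].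
- by left.
- by right; exists a.
- exact: walk_mono (walk_refl _ _).
- by apply: walk_step W; apply/cayley_letterP; exists a.
Qed.

Lemma walk_word w : walk (range s) (size w) 1 (word_eval w).
Proof.
elim: w => [|l w IH]; first exact: walk_refl.
apply: (@walk_step _ _ _ _ _ (letter_eval l)).
  by apply/cayley_letterP; exists l; rewrite mul1g.
by rewrite -[X in walk _ _ X _]mulg1; exact: walk_mul.
Qed.

Lemma walk_wordP l x : walk (range s) l 1 x -> exists w, word_eval w = x.
Proof.
suff H y : walk (range s) l y x -> exists w, y * word_eval w = x.
  by move=> /H[w <-]; exists w; rewrite mul1g.
elim: l y => [y /walk0 ->|l IH y /walk_letterP[->|[a /IH[w <-]]]].
- by exists [::]; rewrite mulg1.
- by exists [::]; rewrite mulg1.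
- by exists (a :: w); rewrite /= mulgA.
Qed.

End Eval.

(** The union of the cosets [t K] for [t] in [ts] contains 1 and is stable under left multiplication
    by letters, hence is all of [G]. *)
Lemma cover_index (G : finGroupType) (s : 'I_r -> G) (ts : seq G) (K : {group G}) :
  (forall x, exists w, word_eval s w = x) ->
  (exists2 t, t \in ts & t^-1 \in K) ->
  (forall l t, t \in ts -> exists2 t', t' \in ts & t'^-1 * letter_eval s l * t \in K) ->
  (#|[set: G]%SET : K| <= size ts)%N.
Proof.
move=> gen [t0 t0ts t0K] step.
have cover w : exists2 t, t \in ts & t^-1 * word_eval s w \in K.
  elim: w => [|l w [t tts tK]]; first by exists t0; rewrite //= mulg1.
  have [t' t'ts t'K] := step l t tts; exists t' => //=.
  by rewrite -(groupMr _ tK) in t'K; rewrite !mulgA mulgK in t'K; rewrite mulgA.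
have sub : [set: G]%SET \subset [set (p.1 * p.2)%g | p in finset.setX [set t in ts]%SET K]%SET.
  apply/fintype.subsetP => x _; have [w <-] := gen x; have [t tts tK] := cover w.
  apply/imsetP; exists (t, t^-1 * word_eval s w); last by rewrite /= mulKVg.
  by rewrite finset.in_setX/= finset.inE tts.
have := leq_trans (subset_leq_card sub) (leq_imset_card _ _).
rewrite cardsX -(Lagrange (finset.subsetT K)) mulnC leq_pmul2r ?cardG_gt0// => /leq_trans; apply.
rewrite (eq_card (B := mem ts)); first exact: card_size.
by move=> x; rewrite finset.inE.
Qed.

End Words.

(** * Ultrafilters and the limit group *)

Section Ultra.
Context {I : Type} (U : set_system I) {UU : UltraFilter U}.

Lemma ultra_or (A B : set I) : U (A `|` B) -> U A \/ U B.
Proof.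
move=> UAB; have [|UnA] := in_ultra_setVsetC A UU; [by left|right].
by apply: filterS2 UAB UnA => x [].
Qed.

Lemma ultra_not (A : set I) : U (~` A) <-> ~ U A.
Proof.
split=> [UnA UA|nUA]; last by case: (in_ultra_setVsetC A UU).
by apply: (@filter_not_empty _ U); rewrite -(setICr A); exact: filterI.
Qed.

(** Finiteness of [T] lets one witness serve almost every [n]: otherwise all the complements, and so
    their finite intersection, would lie in [U]. *)
Lemma ultra_exists (T : finType) (P : T -> set I) :
  U [set n | exists t, P t n] -> exists t, U (P t).
Proof.
move=> UP; apply: contrapT => nP.
have : U [set n | forall t, (~` P t) n].
  by apply: filter_forall => t; apply/ultra_not => ?; apply: nP; exists t.
move=> Un; by have [n [[t Pt] /(_ t)]] := filter_ex (filterI UP Un).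
Qed.

Lemma ultra_all (T : eqType) (s : seq T) (P : T -> set I) :
  (forall t, t \in s -> U (P t)) -> U [set n | forall t, t \in s -> P t n].
Proof.
elim: s => [_|a s IH H]; first by apply: filterS filterT.
have H1 := H a (mem_head _ _).
have H2 : U [set n | forall t, t \in s -> P t n].
  by apply: IH => t ts; apply: H; rewrite inE ts orbT.
by apply: filterS2 H1 H2 => n Pa Ps t; rewrite inE => /predU1P[->|/Ps].
Qed.

(** The values lie in the compact interval from [- M] to [M], and a cluster point of an ultrafilter
    is a limit. *)
Lemma ultra_limit (R : realType) (a : I -> R) (M : R) : (forall n, `|a n| <= M)%R ->
  exists l : R, a @ U --> l.
Proof.
move=> aM; have Fa : U (a @^-1` `[(- M)%R, M]).
  by apply: filterS filterT => n _; rewrite /= in_itv/= -ler_norml.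
have [l [_ cl]] := @segment_compact R _ _ (a @ U) _ Fa; exists l => B /= lB.
have [//|nB] := in_ultra_setVsetC (a @^-1` B) UU.
by have [x [nBx Bx]] := cl _ _ (nB : (a @ U) (~` B)) lB.
Qed.

End Ultra.

Section Limit.
Context {r : nat} (G : nat -> finGroupType) (s : forall n, 'I_r -> G n).
Context (U : set_system nat) (UU : UltraFilter U).
Local Notation letter := ('I_r * bool)%type.
Local Notation ev n := (word_eval (s n)).
Local Open Scope group_scope.

(** The limit is the subgroup of the ultraproduct of the [G n] generated by the classes of the
    generators. It is encoded as words modulo equality of their values in almost every [G n]. *)
Definition ae_eq_word (w v : seq letter) : bool := `[< U [set n | ev n w = ev n v] >].

Let ae_refl : reflexive ae_eq_word.
Proof. by move=> w; apply/asboolP; apply: filterS filterT. Qed.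

Let ae_sym : symmetric ae_eq_word.
Proof. by move=> w v; apply/asboolP/asboolP; apply: filterS => n /= ->. Qed.

Let ae_trans : transitive ae_eq_word.
Proof.
move=> v w u /asboolP wv /asboolP vu; apply/asboolP.
by apply: filterS2 wv vu => n /= -> ->.
Qed.

Canonical ae_equiv := EquivRel ae_eq_word ae_refl ae_sym ae_trans.

Definition limit_group : Type := {eq_quot ae_eq_word}%qT.
HB.instance Definition _ := Choice.on limit_group.
HB.instance Definition _ := EqQuotient.on limit_group.

Definition cls (w : seq letter) : limit_group := (\pi_limit_group w)%qT.
Local Notation rep x := (generic_quotient.repr (x : limit_group)).

Lemma clsP w v : cls w = cls v <-> U [set n | ev n w = ev n v].
Proof.
split=> [/eqmodP H|H]; first exact/asboolP.
by apply/eqmodP/asboolP.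
Qed.

Lemma cls_rep x : cls (rep x) = x. Proof. exact: reprK. Qed.

Lemma ev_rep w : U [set n | ev n (rep (cls w)) = ev n w].
Proof. by apply/clsP; rewrite cls_rep. Qed.

Lemma limit_eqP x y : x = y <-> U [set n | ev n (rep x) = ev n (rep y)].
Proof. by rewrite -{1}(cls_rep x) -{1}(cls_rep y) clsP. Qed.

(** Operations on representatives agree with those of [G n] for almost every [n], so the group laws
    transfer. *)
Let mul x y := cls (rep x ++ rep y).
Let one := cls [::].
Let inv x := cls (word_inv (rep x)).

Let ev_mul x y : U [set n | ev n (rep (mul x y)) = ev n (rep x) * ev n (rep y)].
Proof. by apply: filterS (ev_rep (rep x ++ rep y)) => n /= ->; rewrite word_eval_cat. Qed.

Let ev_inv x : U [set n | ev n (rep (inv x)) = (ev n (rep x))^-1].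
Proof. by apply: filterS (ev_rep (word_inv (rep x))) => n /= ->; rewrite word_eval_inv. Qed.

Let ev_one : U [set n | ev n (rep one) = 1].
Proof. exact: ev_rep. Qed.

Let mulA : associative mul.
Proof.
move=> x y z; apply/limit_eqP.
apply: filterS2 (filterI (ev_mul x (mul y z)) (ev_mul y z))
  (filterI (ev_mul (mul x y) z) (ev_mul x y)) => n /= [-> ->] [-> ->].
by rewrite mulgA.
Qed.

Let mul1 : left_id one mul.
Proof.
by move=> x; apply/limit_eqP; apply: filterS2 (ev_mul one x) ev_one => n /= -> ->; rewrite mul1g.
Qed.

Let mulx1 : right_id one mul.
Proof.
by move=> x; apply/limit_eqP; apply: filterS2 (ev_mul x one) ev_one => n /= -> ->; rewrite mulg1.
Qed.

Let mulV : left_inverse one inv mul.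
Proof.
move=> x; apply/limit_eqP.
apply: filterS2 (filterI (ev_mul (inv x) x) (ev_inv x)) ev_one => n /= [-> ->] ->.
by rewrite mulVg.
Qed.

Let mulxV : right_inverse one inv mul.
Proof.
move=> x; apply/limit_eqP.
apply: filterS2 (filterI (ev_mul x (inv x)) (ev_inv x)) ev_one => n /= [-> ->] ->.
by rewrite mulgV.
Qed.

HB.instance Definition _ := isGroup.Build limit_group mulA mul1 mulx1 mulV mulxV.

Lemma ev_limitM (x y : limit_group) :
  U [set n | ev n (rep (x * y)) = ev n (rep x) * ev n (rep y)].
Proof. exact: ev_mul. Qed.

Lemma ev_limitV (x : limit_group) : U [set n | ev n (rep x^-1) = (ev n (rep x))^-1].
Proof. exact: ev_inv. Qed.

Definition limit_gen (i : 'I_r) : limit_group := cls [:: (i, true)].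

Lemma ev_letter l : U [set n | ev n (rep (letter_eval limit_gen l)) = letter_eval (s n) l].
Proof.
have H i : U [set n | ev n (rep (limit_gen i)) = s n i].
  by apply: filterS (ev_rep [:: (i, true)]) => n /= ->; rewrite /= mulg1.
case: l => i [] /=; first exact: H.
by apply: filterS2 (ev_limitV (limit_gen i)) (H i) => n /= -> ->.
Qed.

Lemma limit_word_eval w : word_eval limit_gen w = cls w.
Proof.
apply/limit_eqP; elim: w => [|l w IH] /=.
  exact: filterS (ev_rep [::]).
apply: filterS2 (filterI (ev_limitM (letter_eval limit_gen l) (word_eval limit_gen w))
  (ev_letter l)) (filterI IH (filterI (ev_rep w) (ev_rep (l :: w)))).
by move=> n /= [-> ->] [-> [-> ->]].
Qed.

(** In the backward direction the first letter of the walk may depend on [n]; as there are finitely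
    many letters, the ultrafilter selects one. *)
Lemma limit_walk l (x y : limit_group) : walk (range limit_gen) l x y <->
  U [set n | walk (range (s n)) l (ev n (rep x)) (ev n (rep y))].
Proof.
elim: l x => [x|l IH x].
  split=> [/walk0 ->|W]; first by apply: filterS filterT => n _; exact: walk_refl.
  have -> : x = y by apply/limit_eqP; apply: filterS W => n /walk0.
  exact: walk_refl.
split=> [/walk_letterP[->|[a /IH W]]|W].
- by apply: filterS filterT => n _; exact: walk_mono (walk_refl _ _).
- apply: filterS2 (filterI (ev_limitM x (letter_eval limit_gen a)) (ev_letter a)) W.
  move=> n /= [-> ->] W.
  by apply/walk_letterP; right; exists a.
apply/walk_letterP.
have /ultra_or[] : U ([set n | ev n (rep x) = ev n (rep y)] `|`
    [set n | exists a, walk (range (s n)) l (ev n (rep x) * letter_eval (s n) a) (ev n (rep y))]).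
  by apply: filterS W => n /walk_letterP.
- by move/limit_eqP; left.
move/ultra_exists => [a Wa]; right; exists a; apply/IH.
apply: filterS2 (filterI (ev_limitM x (letter_eval limit_gen a)) (ev_letter a)) Wa.
by move=> n /= [-> ->].
Qed.

Lemma limit_generates : generates (range limit_gen).
Proof.
apply/seteqP; split=> // x _ H [Hgrp Hs].
have HM := group_closedM Hgrp; have HV := group_closedV Hgrp.
rewrite -(cls_rep x) -limit_word_eval; elim: (rep x) => [|l w IH] /=.
  by have := Hgrp.1; rewrite inE.
have Hl : H (letter_eval limit_gen l).
  have Hi i : H (limit_gen i) by apply: Hs; exists i.
  case: l => i [] /=; first exact: Hi.
  by have := HV (limit_gen i); rewrite !inE; apply; exact: Hi.
by have := HM (letter_eval limit_gen l) (word_eval limit_gen w); rewrite !inE; apply.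
Qed.

(** A walk of the minimal length [m] exists almost everywhere, and each of the finitely many smaller
    lengths fails almost everywhere; so the distances equal the limit distance almost everywhere. *)
Lemma limit_word_dist (R : realType) (x y : limit_group) :
  U [set n | word_dist R (range (s n)) (ev n (rep x)) (ev n (rep y)) =
             word_dist R (range limit_gen) x y].
Proof.
have [l W] : exists l, walk (range limit_gen) l x y.
  exists (size (rep (x^-1 * y))).
  have := walk_mul x (walk_word limit_gen (rep (x^-1 * y))).
  by rewrite mulg1 limit_word_eval cls_rep mulKVg.
have [m dm Wm] := word_dist_walk R W; rewrite dm.
have minm : U [set n | forall i : 'I_m, ~ walk (range (s n)) i (ev n (rep x)) (ev n (rep y))].
  apply: filter_forall => i; apply/ultra_not => /limit_walk/(word_dist_le R).
  by rewrite dm ler_nat leqNgt ltn_ord.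
apply: filterS2 minm (iffLR (limit_walk _ _ _) Wm) => n /= minn {}Wn.
have [m' dm' Wm'] := word_dist_walk R Wn; rewrite dm'; congr _%:R%R.
apply/eqP; rewrite eqn_leq; apply/andP; split.
  by have := word_dist_le R Wn; rewrite dm' ler_nat.
by rewrite leqNgt; apply/negP => mm; exact: (minn (Ordinal mm)).
Qed.

End Limit.

(** * Limits of kernels and the distortion of the limit group *)

Lemma filter_cvg_sum (R : realType) (I T : Type) (F : set_system I) {FF : Filter F}
    (s : seq T) (u : T -> I -> R) (l : T -> R) :
  (forall t, u t n @[n --> F] --> l t) ->
  (\sum_(t <- s) u t n)%R @[n --> F] --> (\sum_(t <- s) l t)%R.
Proof.
move=> ul; elim: s => [|t s IH].
  by under eq_fun do rewrite big_nil; rewrite big_nil; exact: cvg_cst.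
by under eq_fun do rewrite big_cons; rewrite big_cons; exact: cvgD.
Qed.

(** Each entry is bounded uniformly in [n] and so has an ultralimit. Positivity passes to the limit
    because every instance involves finitely many entries. *)
Lemma psd_limit (R : realType) (I : Type) (U : set_system I) {UU : UltraFilter U}
    (kappa : I -> nat -> nat -> R) (M : nat -> nat -> R) : (forall n, psd (kappa n)) ->
  (forall n i j, `|kappa n i j| <= M i j)%R ->
  exists2 K, psd K & forall i j, kappa n i j @[n --> U] --> K i j.
Proof.
move=> kpsd kM; pose K i j : R := lim (kappa n i j @[n --> U]).
have Kcvg i j : kappa n i j @[n --> U] --> K i j.
  by have [l ul] := ultra_limit (fun n => kM n i j); have := cvgP _ ul.
exists K => //; split=> [i j|t].
  by rewrite /K; under eq_fun do rewrite (kpsd _).1.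
have /cvgr_to_ge : qform (kappa n) t @[n --> U] --> qform K t.
  apply: filter_cvg_sum => x; apply: filter_cvg_sum => y.
  by apply: cvgM; [exact: cvg_cst|exact: Kcvg].
by apply; apply: filterS filterT => n _; exact: (kpsd n).2.
Qed.

Section LimitDistortion.
Context {r : nat} (G : nat -> finGroupType) (s : forall n, 'I_r -> G n).
Context (U : set_system nat) (UU : UltraFilter U) (R : realType).
Local Notation letter := ('I_r * bool)%type.
Local Notation ev n := (word_eval (s n)).
Local Notation rep x := (generic_quotient.repr (x : limit_group s UU)).
Local Open Scope ring_scope.

Lemma limit_distortion (D : R) (f : forall n, G n -> L2 (R := R)) : 1 < D ->
  (forall n x y, ((word_dist R (range (s n)) x y)%:E <= L2_dist (f n x) (f n y) <=
    (D * word_dist R (range (s n)) x y)%:E)%E) ->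
  (hilbert_distortion (word_dist R (range (limit_gen s UU))) <= D%:E)%E.
Proof.
move=> D1 fD; have D0 : 0 <= D by lra.
(* Kernels are indexed by natural numbers, so words are replaced by their codes; a number that codes
   no word stands for the empty word. *)
pose word i : seq letter := odflt [::] (unpickle i).
(* Basing the embeddings at the identity bounds the Gram entries by word lengths, uniformly in
   [n]. *)
pose v n i : L2 (R := R) := f n (ev n (word i)) - f n 1%g.
have vB n i j : v n i - v n j = f n (ev n (word i)) - f n (ev n (word j)).
  by rewrite /v opprB addrA subrK.
have norm_le n i : ip (v n i) (v n i) <= (D * (size (word i))%:R) ^+ 2.
  rewrite -[leLHS]sqr_sqrtr ?ip_ge0// ler_sqr ?nnegrE ?sqrtr_ge0 ?mulr_ge0//.
  have /andP[_] := fD n (ev n (word i)) 1%g.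
  rewrite L2_distE lee_fin => /le_trans; apply; rewrite ler_wpM2l//.
  exact/word_dist_le/walk_sym/walk_word.
have ip_bound n i j : `|ip (v n i) (v n j)| <=
    (D * (size (word i))%:R) ^+ 2 + (D * (size (word j))%:R) ^+ 2.
  have aux (a b c A B : R) : 0 <= a + b + 2 * c -> 0 <= a + b - 2 * c ->
      a <= A -> b <= B -> `|c| <= A + B by rewrite ler_norml; lra.
  apply: aux (norm_le n i) (norm_le n j); first by rewrite -ipDD; exact: ip_ge0.
  by rewrite -ipBB; exact: ip_ge0.
have [K psdK Kcvg] := psd_limit (U := U) (fun n => gram_psd (v n)) ip_bound.
have [F FE] := psd_realization psdK.
apply: ereal_inf_lbound; exists D => //=; split=> //.
exists (fun x => F (pickle (rep x))) => x y; rewrite FE.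
set i := pickle (rep x); set j := pickle (rep y).
have wi : word i = rep x by rewrite /word pickleK.
have wj : word j = rep y by rewrite /word pickleK.
set d := word_dist _ _ _ _.
have d0 : 0 <= d by exact: word_dist_ge0.
(* The squared distance of the two images in the [n]-th embedding; its ultralimit is the squared
   distance in the realization of [K]. *)
pose q n := ip (v n i) (v n i) + ip (v n j) (v n j) - 2 * ip (v n i) (v n j).
have Uq : U [set n | d ^+ 2 <= q n <= (D * d) ^+ 2].
  have Ud := limit_word_dist R x y.
  apply: filterS Ud => n /= dE.
  have := fD n (ev n (word i)) (ev n (word j)).
  rewrite L2_distE !lee_fin -vB ipBB -/(q n) {1 2}wi {1 2}wj dE -/d => /andP[dq qd].
  have q0 : 0 <= q n by rewrite /q -ipBB ip_ge0.
  by rewrite -(sqr_sqrtr q0) !ler_sqr ?nnegrE ?sqrtr_ge0 ?mulr_ge0// dq.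
have qcvg : q n @[n --> U] --> K i i + K j j - 2 * K i j.
  apply: cvgB; first by apply: cvgD; exact: Kcvg.
  by apply: cvgM; [exact: cvg_cst|exact: Kcvg].
have lo : d ^+ 2 <= K i i + K j j - 2 * K i j.
  by apply: (cvgr_to_ge qcvg); apply: filterS Uq => n /andP[].
have up : K i i + K j j - 2 * K i j <= (D * d) ^+ 2.
  by apply: (cvgr_to_le qcvg); apply: filterS Uq => n /andP[].
have Q0 : 0 <= K i i + K j j - 2 * K i j by rewrite (le_trans _ lo)// sqr_ge0.
rewrite !lee_fin -(ler_sqr (x := d)) ?nnegrE ?sqrtr_ge0// sqr_sqrtr// lo/=.
by rewrite -(ler_sqr (x := Num.sqrt _)) ?nnegrE ?sqrtr_ge0 ?mulr_ge0// sqr_sqrtr.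
Qed.

End LimitDistortion.

(** * Transfer of abelian subgroups of finite index from the limit to the sequence *)

Section LimitVirtuallyAbelian.
Context {r : nat} (G : nat -> finGroupType) (s : forall n, 'I_r -> G n).
Context (U : set_system nat) (UU : UltraFilter U).
Local Notation letter := ('I_r * bool)%type.
Local Notation ev n := (word_eval (s n)).
Local Notation rep x := (generic_quotient.repr (x : limit_group s UU)).
Local Open Scope group_scope.

(* An abelian subgroup of index k of the limit is carried by finitely many words: coset
   representatives and Schreier generators. The finitely many commutation relations among the
   latter hold in U-almost every G n. *)
Lemma limit_virtually_abelian : (forall n (x : G n), exists w, ev n w = x) ->
  virtually_abelian (limit_group s UU) ->
  exists k, U [set n | exists H : {group G n}, abelian H /\ (#|[set: G n]%SET : H| <= k)%N].
Proof.
move=> gen [H [Hgrp Hcomm /finite_seqP[Cs CsE]]].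
pose L := limit_group s UU; pose letterL := letter_eval (limit_gen s UU).
have H1 : H 1 by have := Hgrp.1; rewrite inE.
have HV x : H x -> H x^-1 by have := group_closedV Hgrp (x := x); rewrite !inE; apply.
(* The choice is made from the coset as a set, so [tau] takes one value per left coset and all its
   values occur in the finite list [ts]. *)
pose tau (x : L) : L := xget 1 [set x * h | h in H].
have tauP x : H ((tau x)^-1 * x).
  have [h Hh E] : [set x * h | h in H] (tau x).
    by apply: (@xgetPex _ 1 [set x * h | h in H]); exists (x * 1), 1.
  by rewrite -E invMg mulgVK; exact: HV.
pose ts := [seq xget 1 C | C <- Cs].
have tau_ts x : tau x \in ts.
  apply/mapP; exists [set x * h | h in H] => //.
  have : [set` Cs] [set x * h | h in H] by rewrite -CsE; exists x.
  by [].
have evL (x : L) : word_eval (limit_gen s UU) (rep x) = x.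
  by rewrite limit_word_eval cls_rep.
pose schreier (l : letter) (t : L) := word_inv (rep (tau (letterL l * t))) ++ l :: rep t.
pose words := word_inv (rep (tau 1)) :: [seq schreier l t | l <- enum {: letter}, t <- ts].
have wordsH w : w \in words -> H (cls s UU w).
  rewrite -limit_word_eval inE => /predU1P[->|/allpairsP[[l t] [_ _ ->]]].
    by rewrite word_eval_inv evL; have := tauP 1; rewrite mulg1.
  by rewrite word_eval_cat word_eval_inv /= !evL; exact: tauP.
have comm_ae : U [set n | forall p, p \in [seq (w, v) | w <- words, v <- words] ->
    ev n p.1 * ev n p.2 = ev n p.2 * ev n p.1].
  apply: ultra_all => -[w v] /allpairsP[[w' v'] [/= wH vH [-> ->]]].
  have : cls s UU (w' ++ v') = cls s UU (v' ++ w').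
    rewrite -!limit_word_eval !word_eval_cat !limit_word_eval.
    by apply: Hcomm; rewrite inE; exact: wordsH.
  by move/clsP; apply: filterS => n /=; rewrite !word_eval_cat.
exists (size ts); apply: filterS comm_ae => n comm_n.
pose A := [set x in [seq ev n w | w <- words]]%SET.
have wordsA w : w \in words -> ev n w \in <<A>>.
  by move=> ww; rewrite mem_gen// finset.inE map_f.
exists <<A>>%G; split.
  rewrite abelian_gen; apply/centsP => x xA y yA.
  move: xA yA; rewrite !finset.in_set => /mapP[w ww ->] /mapP[v vw ->].
  by apply: (comm_n (w, v)); apply/allpairsP; exists (w, v).
have -> : size ts = size [seq ev n (rep t) | t <- ts] by rewrite size_map.
(* A letter carries the coset of [t] to that of [tau (letterL l * t)], since the Schreier word
   relating them evaluates in [<<A>>]. *)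
apply: (cover_index (gen n)).
  exists (ev n (rep (tau 1))); first by rewrite (map_f (fun t : L => ev n (rep t))).
  by rewrite -word_eval_inv; apply: wordsA; rewrite mem_head.
move=> l _ /mapP[t tts ->].
exists (ev n (rep (tau (letterL l * t)))).
  by rewrite (map_f (fun t : L => ev n (rep t))).
have := wordsA (schreier l t); rewrite /schreier word_eval_cat word_eval_inv /= mulgA; apply.
rewrite inE; apply/orP; right; apply/allpairsP; exists (l, t).
by rewrite mem_enum.
Qed.

End LimitVirtuallyAbelian.

(** * Virtually abelian groups *)

Local Close Scope group_scope.
Local Close Scope classical_set_scope.

Section AbelianZmod.
Context (gT : finGroupType) (H : {group gT}) (cH : abelian H).

(** The proof of commutativity is a parameter of the type, so that an additive group structure can
    be attached to it. *)
Definition abelian_zmod of abelian H := subg_of H.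
Local Notation A := (abelian_zmod cH).
HB.instance Definition _ := Finite.on A.

Local Notation sv := (sgval : A -> gT).

Let add (x y : A) : A := (x * y : subg_of H)%g.
Let zero : A := (1 : subg_of H)%g.
Let opp (x : A) : A := ((x : subg_of H)^-1)%g.

Let addA : associative add. Proof. by move=> x y z; apply: val_inj; rewrite /= mulgA. Qed.
Let addC : commutative add.
Proof. by move=> x y; apply: val_inj; apply: (centsP cH); exact: subgP. Qed.
Let add0 : left_id zero add. Proof. by move=> x; apply: val_inj; rewrite /= mul1g. Qed.
Let addN : left_inverse zero opp add.
Proof. by move=> x; apply: val_inj; rewrite /= mulVg. Qed.

HB.instance Definition _ := GRing.isZmodule.Build A addA addC add0 addN.

Lemma sgvalD (x y : A) : sv (x + y) = (sv x * sv y)%g. Proof. by []. Qed.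

Lemma sgvalMn (x : A) n : sv (x *+ n) = (sv x ^+ n)%g.
Proof. by elim: n => // n IH; rewrite mulrS sgvalD IH expgS. Qed.

End AbelianZmod.

(** The representative is selected from the coset as a set, which makes it constant on right cosets;
    [short_coset_rep] keeps it within distance [k] of 1. *)
Lemma coset_rep_exists (G : finGroupType) (S : {set G}) (H : {group G}) (k : nat) :
  (#|[set: G] : H|%g <= k)%N -> <<S>>%g = [set: G] ->
  exists tau : G -> G, [/\ forall x, (x * (tau x)^-1 \in H)%g,
    forall x y, (H :* x = H :* y)%g -> tau x = tau y &
    forall x, walk [set` S]%classic k 1%g (tau x)].
Proof.
move=> iH SG; pose P (C : {set G}) : set G :=
  [set t | t \in C /\ walk [set` S]%classic k 1%g t]%classic.
have PP x : P (H :* x)%g (xget 1%g (P (H :* x)%g)).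
  have [t tx Wt] := short_coset_rep H x SG.
  by apply: (@xgetPex _ 1%g (P (H :* x)%g)); exists t; split=> //; exact: walk_mono iH Wt.
exists (fun x => xget 1%g (P (H :* x)%g)); split.
- move=> x; have [+ _] := PP x; set t := xget _ _.
  by rewrite mem_rcoset -groupV invMg invgK.
- by move=> x y ->.
- by move=> x; have [] := PP x.
Qed.

(* Write x = h(x) tau(x) with h(x) in H. Along an edge of the Cayley graph h(x) is multiplied by one
   of the Schreier generators t l tau(t l)^-1, and these have bounded length in G, so up to constants
   the metric of G is that of h(x) in the Schreier generators plus the discrete metric on cosets. *)
Theorem virtually_abelian_distortion (R : realType) (k r : nat) : exists B : R,
  forall (G : finGroupType) (S : {set G}) (H : {group G}),
  #|S| = r -> <<S>>%g = [set: G] -> abelian H -> (#|[set: G] : H|%g <= k)%N ->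
  (hilbert_distortion (word_dist R [set` S]%classic) <= B%:E)%E.
Proof.
(* At most [k] coset representatives times [r + r] generators and inverses: a bound on the number of
   Schreier generators. *)
pose d := (k * (r + r))%N.
have [C C0 coord] := circle_coordinates R d.
(* The first two summands serve the lower bound on the coordinates, the next two the upper bound,
   and the last makes [1 <= c]. *)
pose c : R := (k.*2.+1 + k.*2)%:R * C + k.*2%:R + 2 * C + k%:R + 1.
(* [B] is left open but cannot depend on [G]; the final estimate determines it from [c] and [d],
   hence from [k] and [r]. *)
eexists => G S H rS SG cH iH.
have [tau [tauH tauE tauW]] := coset_rep_exists iH SG.
pose A : zmodType := abelian_zmod cH.
pose sv : A -> G := sgval.
pose S' : {set G} := S :|: [set s^-1%g | s in S].
pose T : {set G} := [set (p.1 * p.2 * (tau (p.1 * p.2))^-1)%g |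
             p in finset.setX (tau @: [set: G]) S'].
have Td : (#|T| <= d)%N.
  apply: leq_trans (leq_imset_card _ _) _; rewrite cardsX leq_mul//.
    have -> : tau @: [set: G] = [set tau (repr D) | D in rcosets H [set: G]]%SET.
      apply/setP => y; apply/imsetP/imsetP => -[x _ ->].
        exists (H :* x)%g; first by apply/rcosetsP; exists x; rewrite ?inE.
        by apply: tauE; rewrite rcoset_repr.
      by exists (repr x).
    by apply: leq_trans (leq_imset_card _ _) _.
  apply: leq_trans (leq_card_setU _ _) _; rewrite rS leq_add2l -rS.
  exact: leq_imset_card.
have TH t : t \in T -> t \in H.
  case/imsetP => -[u s] /finset.setXP[/imsetP[x _ ->] _] ->.
  suff : (tau x * s * (tau (tau x * s))^-1 \in H)%g by [].
  exact: tauH.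
have cayS' x s : s \in S' -> cayley [set` S]%classic x (x * s)%g.
  rewrite finset.inE => /orP[Ss|/imsetP[u Su ->]].
    by apply/asboolP; exists s => //; left.
  by apply/asboolP; exists u => //; right; rewrite mulgVK.
have TW t : t \in T -> walk [set` S]%classic k.*2.+1 1%g t.
  case/imsetP => -[u s] /finset.setXP[/imsetP[x _ /= ->] Ss] ->.
  have -> : k.*2.+1 = (k + (1 + k))%N by lia.
  apply: walk_trans (tauW x) _; apply: (walk_trans (y := (tau x * s)%g)).
    by apply: walk_step (walk_refl _ _); exact: cayS'.
  have := walk_mul (tau x * s * (tau (tau x * s))^-1)%g (walk_sym (tauW (tau x * s)%g)).
  by rewrite mulg1 mulgVK.
(* The list of Schreier generators is padded with 1 to length exactly [d]. *)
pose a (i : 'I_d) : A := subg H (nth 1%g (enum T) i).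
have aE t : t \in T -> exists i, sv (a i) = t.
  move=> tT; have it : (index t (enum T) < d)%N.
    by apply: leq_trans Td; rewrite cardE index_mem mem_enum.
  exists (Ordinal it); rewrite /sv /a /= nth_index ?mem_enum// subgK//; exact: TH.
have aW i : walk [set` S]%classic k.*2.+1 1%g (sv (a i)).
  rewrite /a /sv; have [iT|iT] := ltnP i #|T|; last first.
    rewrite nth_default ?subgK// -?cardE//.
    exact: walk_mono (walk_refl _ _).
  have nT : nth 1%g (enum T) i \in T by rewrite -mem_enum mem_nth// -cardE.
  by rewrite subgK; [exact: TW|exact: TH].
pose h x : A := subg H (x * (tau x)^-1)%g.
have hE x : sv (h x) = (x * (tau x)^-1)%g by rewrite /sv subgK.
have svD x y : sv (x + y) = (sv x * sv y)%g by [].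
have svN x : sv (- x) = ((sv x)^-1)%g by [].
have svI : injective sv by exact: val_inj.
(* For [y = x * s] the elements [tau x * s] and [y] lie in the same coset, so [h y] is [h x] times
   the Schreier generator of [tau x] and [s]. *)
have step x y : cayley [set` S]%classic x y -> exists i, h y - h x = a i.
  move=> xy; have [s Ss yE] : exists2 s, s \in S' & y = (x * s)%g.
    move: xy => /asboolP[s Ss [] E].
      by exists s => //; rewrite finset.inE Ss.
    by exists s^-1%g; [rewrite inE imset_f ?orbT|rewrite E mulgK].
  have tE : tau (tau x * s)%g = tau y.
    apply: tauE; rewrite yE !rcosetM; congr (_ :* _)%g.
    by apply/rcoset_eqP; rewrite mem_rcoset -groupV invMg invgK.
  have [|i ai] := aE (tau x * s * (tau (tau x * s))^-1)%g.
    by apply/imsetP; exists (tau x, s) => //; rewrite finset.in_setX/= Ss andbT imset_f ?finset.inE.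
  exists i; apply/svI; rewrite ai addrC svD svN !hE tE yE invMg invgK.
  by rewrite !mulgA mulgVK.
pose len (z : 'I_d -> int) := (\sum_i absz (z i))%N.
have lenE z : \sum_i `|z i|%:~R = (len z)%:R :> R.
  by rewrite natr_sum; apply: eq_bigr => i _; rewrite natr_absz.
have rep l x y : walk [set` S]%classic l x y -> exists2 z : 'I_d -> int,
    h y - h x = \sum_i a i *~ z i & (len z <= l)%N.
  have rep0 u : exists2 z : 'I_d -> int, h u - h u = \sum_i a i *~ z i & len z = 0%N.
    exists (fun=> 0); last by rewrite /len big1.
    by rewrite subrr big1// => i _; rewrite mulr0z.
  elim: l x => [x /walk0 ->|l IH x /walk_stepP[->|[u /step[j xu] /IH[z zE zl]]]].
  - by have [z ? lz] := rep0 y; exists z; rewrite ?lz.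
  - by have [z ? lz] := rep0 y; exists z; rewrite ?lz.
  exists (fun i => (i == j)%:Z + z i).
    rewrite -(subrKA (h u)) addrC xu zE; under [RHS]eq_bigr do rewrite mulrzDr.
    rewrite big_split/=; congr (_ + _).
    rewrite (bigD1 j)//= eqxx mulr1z big1 ?addr0// => i /negbTE ->.
    by rewrite mulr0z.
  apply: (@leq_trans (\sum_i ((i == j) + absz (z i)))%N).
    by apply: leq_sum => i _; case: (i == j); lia.
  rewrite big_split/= (bigD1 j)//= eqxx big1 ?addn0 => [|i /negbTE -> //].
  by rewrite add1n ltnS.
have torsion i : a i *+ #|[set: G]| = 0.
  by apply/svI; rewrite [LHS]sgvalMn expg_cardG ?finset.inE.
have gen x : exists z : 'I_d -> int, x = \sum_i a i *~ z i.
  have [l W] := gen_walk 1%g (sv x) SG.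
  have [z zE _] := rep _ _ _ W; exists z; rewrite -zE.
  (* On [H] the representative is constantly [tau 1], so [h (sv x) - h 1] is [x]. *)
  apply/svI; rewrite svD svN !hE mul1g invgK (tauE (sv x) 1%g) ?mulgVK//.
  by rewrite !rcoset_id ?group1//; exact: subgP.
have back (z : 'I_d -> int) : walk [set` S]%classic (k.*2.+1 * len z) 1%g (sv (\sum_i a i *~ z i)).
  rewrite /len; elim: (index_enum _) => [|i s IH].
    by rewrite !big_nil muln0; exact: walk_refl.
  rewrite !big_cons mulnDr svD; apply: (walk_trans (y := sv (a i *~ z i))).
    have pos n : walk [set` S]%classic (k.*2.+1 * n) 1%g (sv (a i *+ n)).
      elim: n => [|n IHn]; first by rewrite muln0; exact: walk_refl.
      rewrite mulnS mulrS svD; apply: walk_trans (aW i) _.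
      by have := walk_mul (sv (a i)) IHn; rewrite mulg1.
    case: (z i) => n; first exact: pos.
    rewrite NegzE mulrNz svN /=; have := walk_mul (sv (a i *+ n.+1))^-1%g (walk_sym (pos n.+1)).
    by rewrite mulVg mulg1.
  by have := walk_mul (sv (a i *~ z i)) IH; rewrite mulg1.
have [|theta [w [w0 up lo]]] := coord A a _ gen.
  by exists #|[set: G]| => //; exact: cardG_gt0.
pose ix x : nat := index (H :* x)%g (enum (rcosets H [set: G])).
(* Two coordinates for each circle, as in [distZ_square], and one that separates the cosets. *)
pose phi x (i : 'I_d + 'I_d + 'I_1) : R := match i with
  | inl (inl i) => w i * distZ (theta i (h x))
  | inl (inr i) => w i * distZ (theta i (h x) + 4^-1)
  | inr _ => (ix x)%:R
  end.
pose nu x y := \sum_i w i * distZ (theta i (h x) - theta i (h y)).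
pose Phi x y := \sum_i `|phi x i - phi y i|.
have nu_ge0 x y : 0 <= nu x y by apply: sumr_ge0 => i _; rewrite mulr_ge0 ?distZ_ge0.
have PhiE x y : Phi x y = \sum_i w i * (`|distZ (theta i (h x)) - distZ (theta i (h y))| +
    `|distZ (theta i (h x) + 4^-1) - distZ (theta i (h y) + 4^-1)|) +
    `|(ix x)%:R - (ix y)%:R|.
  rewrite /Phi !big_sumType big_ord1/=; congr (_ + _).
  rewrite -big_split/=; apply: eq_bigr => i _.
  by rewrite -!mulrBr !normrM (ger0_norm (w0 i)) mulrDr.
have nu_Phi x y : nu x y + `|(ix x)%:R - (ix y)%:R| <= Phi x y.
  rewrite PhiE lerD2r; apply: ler_sum => i _.
  by rewrite ler_wpM2l// distZ_square.
have Phi_nu x y : Phi x y <= 2 * nu x y + `|(ix x)%:R - (ix y)%:R|.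
  rewrite PhiE lerD2r mulr_sumr; apply: ler_sum => i _.
  rewrite mulrCA ler_wpM2l// mulr_natl mulr2n lerD ?distZ_lip//.
  by rewrite (le_trans (distZ_lip _ _))// opprD addrACA subrr addr0.
have ixk x y : `|(ix x)%:R - (ix y)%:R| <= k%:R :> R.
  have ixle u : (ix u)%:R <= k%:R :> R.
    by rewrite ler_nat; apply: leq_trans iH; rewrite /indexg cardE index_size.
  have := ixle x; have := ixle y; have := ler0n R (ix x); have := ler0n R (ix y).
  by rewrite ler_norml; lra.
have len_nu x y : exists2 z : 'I_d -> int, h y - h x = \sum_i a i *~ z i & (len z)%:R <= C * nu x y.
  have [z zE zl] := lo (h y) (h x); exists z; rewrite // -lenE.
  apply: le_trans zl _; rewrite ler_pM2l//; apply: ler_sum => i _.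
  by rewrite -distZN opprB.
have c1 : 1 <= c by rewrite lerDr !addr_ge0// ?mulr_ge0// ltW.
have c0 : 0 <= c by rewrite (le_trans ler01).
apply: (@hilbert_distortion_coord _ _ _ _ phi c).
- exact: c1.
- move=> x y; rewrite -/(Phi x y).
  have [z zE zl] := len_nu x y.
  have Wh u : walk [set` S]%classic k (sv (h u)) u.
    have := walk_mul (sv (h u)) (tauW u); rewrite mulg1.
    by rewrite hE mulgVK.
  have Wxy : walk [set` S]%classic (k.*2 + k.*2.+1 * len z) x y.
    have -> : (k.*2 + k.*2.+1 * len z = k + k.*2.+1 * len z + k)%N by lia.
    apply: walk_trans (Wh y); apply: walk_trans (walk_sym (Wh x)) _.
    have := walk_mul (sv (h x)) (back z).
    by rewrite mulg1 -zE -svD addrC subrK.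
  set delta : R := `|(ix x)%:R - (ix y)%:R|; have delta0 : 0 <= delta by exact: normr_ge0.
  have [xy|xy] := eqVneq x y.
    rewrite xy (le_trans (word_dist_le R (walk_refl _ y)))// mulr_ge0// ?sumr_ge0//.

  (* Distinct points either lie in different cosets, or have the same representative and hence
     different [h]. This absorbs the additive error [k.*2] of the walk into the linear terms. *)
  have len_delta : 1 <= (len z)%:R + delta.
    have [ixy|ixy] := eqVneq (ix x) (ix y); last first.
      have dist_ge1 (u v : nat) : u != v -> 1 <= `|u%:R - v%:R| :> R.
        wlog uv : u v / (u <= v)%N => [wl|] neq.
          by have [/wl|/ltnW/wl] := leqP u v; [|rewrite distrC eq_sym]; exact.
        rewrite distrC ger0_norm ?subr_ge0 ?ler_nat// -natrB// ler1n subn_gt0.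
        by rewrite ltn_neqAle neq.
      by rewrite (le_trans (dist_ge1 _ _ ixy))// lerDr.
    have mem u : (H :* u)%g \in enum (rcosets H [set: G]).
      by rewrite mem_enum; apply/rcosetsP; exists u; rewrite ?finset.inE.
    have cxy : (H :* x)%g = (H :* y)%g.
      by rewrite -(nth_index (H :* 1)%g (mem x)) -/(ix x) ixy nth_index.
    rewrite (le_trans _ (_ : (len z)%:R <= _)) ?lerDl// ler1n lt0n.
    apply: contraNneq xy => len0.
    have z0 i : z i = 0.
      by move/eqP: len0; rewrite sum_nat_eq0 => /forallP/(_ i); rewrite absz_eq0 => /eqP.
    have : h y - h x = 0 by rewrite zE big1// => i _; rewrite z0 mulr0z.
    move=> /eqP; rewrite subr_eq0 => /eqP/(congr1 sv).
    by rewrite !hE (tauE _ _ cxy) => /mulIg ->.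
  have K0 : 0 <= k.*2%:R :> R by [].
  have E : word_dist R [set` S]%classic x y <=
      (k.*2.+1 + k.*2)%:R * (len z)%:R + k.*2%:R * delta.
    apply: le_trans (word_dist_le R Wxy) _.
    have := ler_wpM2l K0 len_delta.
    by rewrite !natrD natrM -natr1 mulr1 mulrDr; lra.
  apply: le_trans E _; apply: le_trans (_ : _ <= c * (nu x y + delta)) _; last first.
    by rewrite ler_wpM2l.
  have k0 := ler0n R k; have K1 := mulr_ge0 (ler0n R (k.*2.+1 + k.*2)) (ltW C0).
  rewrite mulrDr lerD//.
    apply: (@le_trans _ _ ((k.*2.+1 + k.*2)%:R * (C * nu x y))); first by rewrite ler_wpM2l.
    by rewrite mulrA ler_wpM2r// /c; lra.
  by rewrite ler_wpM2r// /c; lra.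
- move=> x y; rewrite -/(Phi x y).
  have [l W] := gen_walk x y SG.
  have [{W}m -> W] := word_dist_walk R W.
  have [z zE zm] := rep _ _ _ W.
  have nu_m : nu x y <= C * m%:R.
    have := up _ _ _ zE; rewrite lenE => /le_trans zC.
    rewrite (le_trans _ (zC _ (ler_wpM2l (ltW C0) _))) ?ler_nat//.
    by apply: ler_sum => i _; rewrite -[in leLHS]distZN opprB.
  have ix_m : `|(ix x)%:R - (ix y)%:R| <= k%:R * m%:R :> R.
    case: m W {zm nu_m} => [/walk0 ->|m _]; first by rewrite subrr normr0 mulr0.
    by rewrite (le_trans (ixk x y))// ler_peMr// ler1n.
  have Cm : 0 <= (k.*2.+1 + k.*2)%:R * C * m%:R by rewrite !mulr_ge0// ltW.
  have km : 0 <= k.*2%:R * m%:R :> R by rewrite mulr_ge0.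
  have := Phi_nu x y; have := ler0n R m.
  by rewrite /c !mulrDl mul1r; lra.
Qed.

Local Open Scope classical_set_scope.

(** * Generating sets and ranks of finite groups *)

Lemma enum_range (G : finGroupType) (S : {set G}) r : #|S| = r ->
  range (fun i : 'I_r => nth 1%g (enum S) i) = [set` S].
Proof.
move=> Sr; have size_S : size (enum S) = r by rewrite -cardE.
apply/seteqP; split=> [_ [i _ <-]|x Sx] /=.
  by rewrite -mem_enum mem_nth// size_S.
have xS : x \in enum S by rewrite mem_enum.
have ix : (index x (enum S) < r)%N by rewrite -size_S index_mem.
by exists (Ordinal ix) => //=; rewrite nth_index.
Qed.

Lemma enum_words (G : finGroupType) (S : {set G}) r : #|S| = r ->
  <<S>>%g = [set: G]%SET ->
  forall x, exists w, word_eval (fun i : 'I_r => nth 1%g (enum S) i) w = x.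
Proof.
move=> Sr SG x; have [l] := gen_walk 1%g x SG.
by rewrite -(enum_range Sr) => /walk_wordP.
Qed.

(** Schreier's lemma: by [cover_index] the Schreier generators, which lie in [H], generate a
    subgroup of index at most that of [H], hence [H] itself. The element [(tau 1)^-1] gives the base
    case and accounts for the successor in the bound. *)
Lemma grank_index (G : finGroupType) (H : {group G}) :
  ('m(H) <= (('m([set: G]%SET) * 2) * #|[set: G]%SET : H|).+1)%N%g.
Proof.
have [S SG Sr] := grank_witness [set: G]%G.
set r := 'm([set: G]%SET)%g.
pose l_eval := letter_eval (fun i : 'I_r => nth 1%g (enum S) i).
pose tau x : G := repr (x *: H)%g.
have tauH x : ((tau x)^-1 * x)%g \in H.
  by rewrite -mem_lcoset lcoset_sym (mem_repr x)// lcoset_refl.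
pose T := [set tau x | x in [set: G]%SET]%SET.
have cardT : (#|T| <= #|[set: G]%SET : H|%g)%N.
  have -> : T = [set repr C | C in lcosets H [set: G]%SET]%SET.
    rewrite -imset_comp; apply: eq_imset => x /=.
    by rewrite lcosetE.
  by apply: leq_trans (leq_imset_card _ _) _; rewrite card_lcosets.
pose gam (p : ('I_r * bool) * G) : G := ((tau (l_eval p.1 * p.2))^-1 * (l_eval p.1 * p.2))%g.
pose B := ((tau 1)^-1 |: [set gam p | p in finset.setX [set: 'I_r * bool] T])%g%SET.
have cardB : (#|B| <= ((r * 2) * #|[set: G]%SET : H|%g).+1)%N.
  rewrite cardsU1 -add1n leq_add ?leq_b1//.
  apply: leq_trans (leq_imset_card _ _) _.
  by rewrite cardsX cardsT card_prod card_ord card_bool leq_mul2l cardT orbT.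
apply: leq_trans cardB; suff {1}<- : <<B>>%g = H by exact: grank_min.
have BH : <<B>>%g \subset H.
  rewrite gen_subG; apply/fintype.subsetP => x; rewrite in_setU1 => /predU1P[->|].
    by have := tauH 1%g; rewrite mulg1.
  by case/imsetP => p _ ->; exact: tauH.
apply/eqP; rewrite eqEcard BH/=.
have index_le : (#|[set: G]%SET : <<B>>%g|%g <= #|[set: G]%SET : H|%g)%N.
  apply: leq_trans cardT; rewrite cardE.
  apply: (cover_index (enum_words Sr SG)).
    exists (tau 1%g); first by rewrite mem_enum imset_f ?finset.inE.
    by rewrite mem_gen// in_setU1 eqxx.
  move=> l t; rewrite mem_enum => tT; exists (tau (l_eval l * t)%g).
    by rewrite mem_enum imset_f ?finset.inE.
  rewrite -mulgA mem_gen// in_setU1; apply/orP; right.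
  by apply/imsetP; exists (l, t); rewrite // finset.in_setX finset.inE.
have := Lagrange (finset.subsetT H); rewrite -(Lagrange (finset.subsetT <<B>>%G)) => E.
rewrite -(leq_pmul2r (indexg_gt0 [set: G]%G H)) E leq_mul2l.
by rewrite index_le orbT.
Qed.

(** A minimal generating set is padded with arbitrary further elements. *)
Lemma generating_set_of_card (G : finGroupType) r :
  ('m([set: G]%SET)%g <= r)%N -> (r <= #|G|)%N -> exists S : {set G}, gen_sets r S.
Proof.
move=> mr rG; have [S SG Sm] := grank_witness [set: G]%G.
pose E := [set x in take (r - #|S|) (enum (~: S)%SET)]%SET.
have cardE' : #|E| = (r - #|S|)%N.
  rewrite cardsE (card_uniqP _) ?take_uniq ?enum_uniq// size_takel//.
  by rewrite -cardE -(addKn #|S| #|(~: S)%SET|) cardsC leq_sub2r.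
exists (S :|: E)%SET; split.
  rewrite cardsU cardE' (_ : S :&: E = finset.set0)%SET ?cards0 ?subn0 ?subnKC ?Sm//.
  apply/setP => x; rewrite !finset.inE; apply/negP => /andP[Sx /mem_take].
  by rewrite mem_enum finset.inE Sx.
apply/eqP; rewrite finset.eqEsubset finset.subsetT/=.
have SE : <<S>>%g \subset <<S :|: E>>%g by rewrite genS// finset.subsetUl.
by apply: fintype.subset_trans SE; rewrite SG.
Qed.

Theorem bounded_abelian_index (R : realType) (r : nat) (D : R) :
  (forall (G : groupType) (S : set G), finite_set S -> generates S ->
     hilbert_distortion (word_dist R S) < +oo -> virtually_abelian G)%E ->
  exists k, forall (G : finGroupType) (S : {set G}),
    gen_sets r S -> (hilbert_distortion (word_dist R [set` S]) < D%:E)%E ->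
    exists H : {group G}, abelian H /\ (#|[set: G]%SET : H|%g <= k)%N.
Proof.
move=> CTV; apply: contrapT => Hk.
(* The group and its generating set are bundled into one dependent pair, so that a single choice
   yields the whole sequence. *)
have bad k : exists X : {G : finGroupType & {set G}}, [/\ gen_sets r (projT2 X),
    (hilbert_distortion (word_dist R [set` projT2 X]) < D%:E)%E &
    ~ exists H : {group projT1 X}, abelian H /\ (#|[set: projT1 X]%SET : H|%g <= k)%N].
  apply: contrapT => nX; apply: Hk; exists k => G S genS SD; apply: contrapT => nH.
  by apply: nX; exists (existT _ G S).
have [X XP] := choice bad; pose G n := projT1 (X n); pose S n : {set G n} := projT2 (X n).
have Sr n : #|S n| = r by have [[]] := XP n.
have SG n : <<S n>>%g = [set: G n]%SET by have [[]] := XP n.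
pose s n (i : 'I_r) : G n := nth 1%g (enum (S n)) i.
have D1 : (1 < D)%R.
  have [_ + _] := XP 0%N; move=> /ereal_inf_lt[_ [D' [D'1 _] <-]].
  by rewrite lte_fin; exact: lt_trans.
(* The infimum being below [D], some admissible constant is too; relaxing it to [D] gives all
   embeddings the same constant. *)
have fex n : exists f : G n -> L2 (R := R), forall x y,
    ((word_dist R (range (s n)) x y)%:E <= L2_dist (f x) (f y) <=
    (D * word_dist R (range (s n)) x y)%:E)%E.
  have [_ + _] := XP n; rewrite -(enum_range (Sr n)).
  move=> /ereal_inf_lt[_ [D' [D'1 [f fD']] <-]]; rewrite lte_fin => D'D.
  exists f => x y; have /andP[-> /le_trans] := fD' x y; apply.
  by rewrite lee_fin ler_wpM2r ?word_dist_ge0// ltW.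
pose f n := sval (cid (fex n)).
have [U [UU ooU]] := ultraFilterLemma (F := \oo) _.
have LD := limit_distortion (s := s) UU D1 (fun n => svalP (cid (fex n))).
have [|k Uk] := limit_virtually_abelian (s := s) (UU := UU) (fun n => enum_words (Sr n) (SG n)).
  apply: (CTV _ (range (limit_gen s UU))).
  - exact: finite_image.
  - exact: limit_generates.
  - exact: le_lt_trans LD (ltry _).
(* [U] contains the cofinite filter, so some [n] with the subgroup of index at most [k] also
   satisfies [k <= n], against the choice of [X n]. *)
have [n [[H [cH iH]] kn]] : exists n, (exists H : {group G n},
    abelian H /\ (#|[set: G n]%SET : H|%g <= k)%N) /\ (k <= n)%N.
  apply: (@filter_ex _ U); apply: filterI Uk _; apply: ooU.
  exact: nbhs_infty_ge.
have [_ _] := XP n; apply; exists H; split=> //.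
exact: leq_trans iH kn.
Qed.

(** * Comparison of the five conditions *)

Section Conditions.
Context (R : realType) (G : nat -> finGroupType).
Local Open Scope ereal_scope.

Lemma lty_nat (x : \bar R) : x < +oo -> exists r : nat, x < (r%:R : R)%:E.
Proof.
case: x => [x _| |]//; last by exists 0%N; rewrite ltNyr.
by exists (Num.truncn `|x|).+1; rewrite lte_fin (le_lt_trans (ler_norm x))// truncnS_gt.
Qed.

Lemma rank_le_sup_rank n (r : nat) : sup_rank R G <= (r%:R : R)%:E ->
  ('m([set: G n]%SET)%g <= r)%N.
Proof.
move=> Gr; rewrite -(ler_nat R) -lee_fin; apply: le_trans Gr.
by apply: ereal_sup_ubound; exists n.
Qed.

(** For [r <= #|G n|] and [r] at least the rank there is a generating set of size [r], so the inner
    infimum and supremum run over a nonempty family. *)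
Lemma best_le_worst (r : nat) : sup_rank R G <= (r%:R : R)%:E ->
  best_distortion R G r <= worst_distortion R G r.
Proof.
move=> Gr; apply: ge_ereal_sup => _ [n /= rn <-].
have [S gS] := generating_set_of_card (rank_le_sup_rank n Gr) rn.
have inf_le : ereal_inf (@distortions R G n r) <= hilbert_distortion (word_dist R [set` S]).
  by apply: ereal_inf_lbound; exists S.
have le_sup : hilbert_distortion (word_dist R [set` S]) <= ereal_sup (@distortions R G n r).
  by apply: ereal_sup_ubound; exists S.
apply: le_trans inf_le (le_trans le_sup _).
by apply: ereal_sup_ubound; exists n.
Qed.

End Conditions.

Local Open Scope ereal_scope.

Theorem corollary2 (R : realType) :
  (forall (G : groupType) (S : set G), finite_set S -> generates S ->
     (hilbert_distortion (word_dist R S) < +oo <-> virtually_abelian G)) ->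
  forall G : nat -> finGroupType, sup_rank R G < +oo ->
  [<-> forall r : nat, sup_rank R G < (r%:R : R)%:E ->
         worst_distortion R G r < +oo;
       exists r : nat, sup_rank R G <= (r%:R : R)%:E /\
         worst_distortion R G r < +oo;
       forall r : nat, sup_rank R G < (r%:R : R)%:E ->
         best_distortion R G r < +oo;
       exists r : nat, best_distortion R G r < +oo;
       exists (r : nat) (H : forall n, {group G n}),
         (forall n, abelian (H n) /\ ('m(H n)%g <= r)%N) /\
         ereal_sup [set (#|[set: G n]%SET : H n|%g%:R : R)%:E | n in [set: nat]]
           < +oo ].
Proof.
move=> CTV G Gy; have [r0 Gr0] := lty_nat Gy.
set P1 := (forall r : nat, _ -> (worst_distortion R G r < +oo)%E).
set P2 := (exists r : nat, _ /\ _).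
set P3 := (forall r : nat, _ -> (best_distortion R G r < +oo)%E).
set P4 := (exists r : nat, (best_distortion R G r < +oo)%E).
set P5 := (exists (r : nat) (H : forall n, {group G n}), _).
have h12 : P1 -> P2 by move=> h; exists r0; split; [exact: ltW|exact: h].
have h13 : P1 -> P3.
  by move=> h r Gr; exact: le_lt_trans (best_le_worst (ltW Gr)) (h r Gr).
have h24 : P2 -> P4.
  by move=> [r [Gr h]]; exists r; exact: le_lt_trans (best_le_worst Gr) h.
have h34 : P3 -> P4 by move=> h; exists r0; exact: h.
have h45 : P4 -> P5.
  move=> [r /lty_nat[D rD]].
  have [k kP] := bounded_abelian_index r D%:R (fun G S finS genS => (CTV G S finS genS).1).
  (* A group with fewer than [r] elements does not enter [best_distortion]; its trivial subgroup has
     index less than [r], whence [maxn k r]. *)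
  have Hex n : exists H : {group G n}, abelian H /\ (#|[set: G n]%SET : H|%g <= maxn k r)%N.
    have [nr|rn] := ltnP #|G n| r.
      exists 1%G; split; first exact: abelian1.
      by rewrite indexg1 cardsT leq_max (ltnW nr) orbT.
    have /ereal_inf_lt[_ [S gS <-] SD] : (ereal_inf (@distortions R G n r) < (D%:R : R)%:E)%E.
      by apply: le_lt_trans rD; apply: ereal_sup_ubound; exists n.
    have [H [cH iH]] := kP _ _ gS SD; exists H; split=> //.
    by rewrite leq_max iH.
  pose H n := sval (cid (Hex n)); have HP n := svalP (cid (Hex n)).
  (* The rank bound of [grank_index], with [r0] bounding the ranks of all [G n]. *)
  exists (((r0 * 2) * maxn k r).+1), H; split.
    move=> n; have [cH iH] := HP n; split=> //.
    apply: leq_trans (grank_index _) _; rewrite ltnS leq_mul// leq_mul2r orbC.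
    by rewrite (rank_le_sup_rank n (ltW Gr0)).
  apply: le_lt_trans (ltry ((maxn k r)%:R : R)); apply: ge_ereal_sup => _ [n _ <-].
  by rewrite lee_fin ler_nat; have [] := HP n.
have h51 : P5 -> P1.
  move=> [rH [H [Hab /lty_nat[k Hk]]]] r Gr.
  have [B BP] := virtually_abelian_distortion R k r.
  apply: le_lt_trans (ltry B); apply: ge_ereal_sup => _ [n _ <-].
  apply: ge_ereal_sup => _ [S [Sr SG] <-].
  apply: (BP _ _ (H n)) => //; first by have [] := Hab n.
  rewrite -(ler_nat R) -lee_fin; apply: le_trans (ltW Hk).
  by apply: ereal_sup_ubound; exists n.
tfae.
- exact: h12.
(* Condition 2 reaches condition 3 through 4, 5 and 1. *)
- by move=> /h24/h45/h51/h13.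
- exact: h34.
- exact: h45.
- exact: h51.
Qed.
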